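(* Let $\mathbb{K}$ be a field (of any characteristic), let $I$ be a homogeneous ideal of the standard graded polynomial ring $A=\mathbb{K}[X_1,\dots,X_n]$, let $\tau$ be a monomial order with $X_1>\dots>X_n$, and let $d$ be an integer such that $I$ has no minimal generator of degree $d$ or larger. If the zero-generic initial ideal $\operatorname{gin}_0(I)$ of $I$ with respect to $\tau$ has no minimal generator in degree $d$, then it also has no minimal generator in degree larger than $d$.
   Context: Base change of monomial ideals: if $I$ is a monomial ideal of $A_F=F[X_1,\dots,X_n]$ ($F$ a field) and $F'$ is another field, $I_{F'}$ denotes the ideal of $A_{F'}=F'[X_1,\dots,X_n]$ generated by the same (monic) monomials. Generic initial ideal: for a field $F$, a homogeneous ideal $I\subseteq A_F$ and a monomial order $\tau$, let ${\bf y}=(y_{ij})_{1\le i,j\le n}$ be indeterminates, let $\gamma: A_F\to A_{F({\bf y})}$ be the $F$-algebra homomorphism $X_i\mapsto\sum_{j=1}^n y_{ij}X_j$, and let $J$ be the initial ideal with respect to $\tau$ of the ideal of $A_{F({\bf y})}$ generated by $\gamma(I)$. Then $\operatorname{gin}_\tau(I):=J_F$, a monomial ideal of $A_F$. When $F$ is infinite, it equals $\operatorname{in}_\tau(gI)$ for all $g$ in a non-empty Zariski open subset of $\operatorname{GL}_n(F)$. Zero-generic initial ideal: for a homogeneous ideal $I$ of $A=A_{\mathbb{K}}$, $$\operatorname{gin}_0(I):=\bigl(\operatorname{gin}_\tau\bigl((\operatorname{gin}_\tau(I))_{\mathbb{Q}}\bigr)\bigr)_{\mathbb{K}}.$$ 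*)

(* Defs.v *)
From HB Require Import structures.
From mathcomp Require Import all_boot all_order all_algebra.
From mathcomp Require Import fraction.
From mathcomp Require Import mpoly.

Set Implicit Arguments.
Unset Strict Implicit.
Unset Printing Implicit Defensive.

Import GRing.Theory.
Local Open Scope ring_scope.

(* Ideals are Prop-valued predicates: the [idealr] structure of ring_quotient
   only covers proper ideals with a decidable membership test. *)
Section Ideals.
Variable R : comNzRingType.
Implicit Types I S : R -> Prop.

Definition is_ideal I : Prop :=
  [/\ I 0, forall p q, I p -> I q -> I (p + q) & forall a p, I p -> I (a * p)].

Definition ideal_gen S : R -> Prop := fun p =>
  exists r : seq (R * R),
    (forall x, x \in r -> S x.2) /\ p = \sum_(x <- r) x.1 * x.2.

Definition generates S I : Prop := forall p, ideal_gen S p <-> I p.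

End Ideals.

Section HomogeneousIdeals.
Variables (n : nat) (F : fieldType).
Implicit Types I G : {mpoly F[n]} -> Prop.

Definition homogeneous_ideal I : Prop :=
  is_ideal I /\ forall p d, I p -> I (pihomog mdeg d p).

Definition minimal_homog_gens I G : Prop :=
  [/\ forall g, G g -> g \is homog mdeg,
      generates G I
    & forall g, G g -> ~ generates (fun h => G h /\ h <> g) I].

(* For a homogeneous ideal, the degrees of the elements of a minimal system of
   homogeneous generators do not depend on the system.  Minimality excludes the
   zero polynomial, which is k.-homog for every k.  Degrees are in int; there is
   no generator in a negative degree. *)
Definition has_min_gen_in_degree I (d : int) : Prop :=
  exists G g (k : nat),
    [/\ minimal_homog_gens I G, G g, g \is k.-homog & d = k%:Z].

End HomogeneousIdeals.

Definition monomial_order (n : nat) (le : rel 'X_{1..n}) : Prop :=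
  [/\ antisymmetric le, transitive le, total le,
      forall m, le 0%MM m
    & forall m m1 m2, le m1 m2 -> le (m + m1)%MM (m + m2)%MM].

(* X_1 > ... > X_n; for a total [le], [~~ le m1 m2] means m1 > m2. *)
Definition decreasing_variables (n : nat) (le : rel 'X_{1..n}) : Prop :=
  forall i j : 'I_n, (i < j)%N -> ~~ le U_(i)%MM U_(j)%MM.

Section InitialIdeal.
Variables (n : nat) (F : fieldType) (le : rel 'X_{1..n}).

Definition initial_monomial (p : {mpoly F[n]}) (m : 'X_{1..n}) : Prop :=
  m \in msupp p /\ forall m', m' \in msupp p -> le m' m.

Definition initial_ideal (I : {mpoly F[n]} -> Prop) : {mpoly F[n]} -> Prop :=
  ideal_gen (fun q => exists p m, [/\ I p, initial_monomial p m & q = 'X_[m]]).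

End InitialIdeal.

(* I_{F'}, meaningful for I a monomial ideal. *)
Definition base_change (n : nat) (F F' : fieldType)
    (I : {mpoly F[n]} -> Prop) : {mpoly F'[n]} -> Prop :=
  ideal_gen (fun q => exists m, I 'X_[m] /\ q = 'X_[m]).

Section GenericInitialIdeal.
Variables (n : nat) (F : fieldType) (le : rel 'X_{1..n}).

(* F(y): the n^2 indeterminates y_ij are numbered by [mxvec_index i j]. *)
Definition Fy : fieldType := {fraction {mpoly F[n * n]}}.

Definition Fy_const (c : F) : Fy := FracField.tofrac (c%:MP_[n * n]).

Definition Fy_var (i j : 'I_n) : Fy :=
  FracField.tofrac ('X_(mxvec_index i j) : {mpoly F[n * n]}).

Definition generic_change (p : {mpoly F[n]}) : {mpoly Fy[n]} :=
  mmap (fun c => (Fy_const c)%:MP_[n])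
       (fun i => \sum_(j < n) Fy_var i j *: 'X_j) p.

Definition gin (I : {mpoly F[n]} -> Prop) : {mpoly F[n]} -> Prop :=
  base_change (F' := F)
    (initial_ideal le
      (ideal_gen (fun q => exists p, I p /\ q = generic_change p))).

End GenericInitialIdeal.

Definition gin0 (n : nat) (K : fieldType) (le : rel 'X_{1..n})
    (I : {mpoly K[n]} -> Prop) : {mpoly K[n]} -> Prop :=
  base_change (F' := K) (gin le (base_change (F' := rat) (gin le I))).

(* Main.v *)
From Stdlib Require Import ClassicalEpsilon Relation_Operators.
From HB Require Import structures.
Require Import Defs.
From mathcomp Require Import all_boot all_order all_algebra.
From mathcomp Require Import fraction generic_quotient.
From mathcomp Require Import mpoly.

Set Implicit Arguments.
Unset Strict Implicit.
Unset Printing Implicit Defensive.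

Import GRing.Theory.
Local Open Scope ring_scope.

(* Write e = d - 1, N for gin(I) transported to rat, C and B for the sets of
   monomials of degree e in gin(N) and in gin(I).  Call a set of monomials of
   degree e connected if for each m its members dividing m are linked by steps
   X_i c = X_j c', i.e. if its syzygies are generated by the linear ones.
   1. In characteristic 0, gin(N) is strongly stable, so C is connected.
   2. gin(N) has no new generator in degree e + 1, so all S-pairs of linear type
      between the elements of a Groebner basis in degree e reduce to 0.  With the
      connectedness of C, all syzygies of the degree e part of the generic
      transform of N are generated by the linear ones.  Undoing the generic
      change of coordinates, the same holds for N, that is, B is connected, and
      N has no new generator in degree e + 1.
   3. Connectedness is a combinatorial property of B, independent of the field.
      Over K, Buchberger's criterion then only has to be checked in degree e + 1,
      where it holds, so gin(I) has no new generator in degree > e.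
   4. Hence N is generated in degrees <= e, and Buchberger's criterion with C
      connected gives the same for gin(N). *)

(** * Ideals, spans and monomials *)

Section IdealGen.
Variable R : comNzRingType.
Implicit Types I S : R -> Prop.

Lemma ideal_gen_is_ideal S : is_ideal (ideal_gen S).
Proof.
split.
- by exists [::]; split=> //; rewrite big_nil.
- move=> _ _ [r [Sr ->]] [s [Ss ->]]; exists (r ++ s); split.
    by move=> x; rewrite mem_cat => /orP[/Sr|/Ss].
  by rewrite big_cat.
- move=> a _ [r [Sr ->]]; exists [seq (a * x.1, x.2) | x <- r]; split.
    by move=> _ /mapP[x /Sr Sx ->].
  by rewrite big_map mulr_sumr; apply: eq_bigr => x _; rewrite mulrA.
Qed.

Lemma ideal_gen_sub S x : S x -> ideal_gen S x.
Proof.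
move=> Sx; exists [:: (1, x)]; split; last by rewrite big_seq1 mul1r.
by move=> y; rewrite inE => /eqP->.
Qed.

Lemma ideal_sum I (T : eqType) (r : seq T) (f : T -> R) : is_ideal I ->
  (forall x, x \in r -> I (f x)) -> I (\sum_(x <- r) f x).
Proof.
case=> I0 ID _; elim: r => [|x r IH] If; first by rewrite big_nil.
rewrite big_cons; apply: ID; first by apply: If; rewrite mem_head.
by apply: IH => y yr; apply: If; rewrite inE yr orbT.
Qed.

Lemma ideal_gen_min S I : is_ideal I -> (forall x, S x -> I x) ->
  forall x, ideal_gen S x -> I x.
Proof.
move=> idI SI _ [r [Sr ->]]; apply: ideal_sum => // x xr.
by case: idI => _ _; apply; apply/SI/Sr.
Qed.

Lemma ideal_gen_mono S T : (forall x, S x -> T x) ->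
  forall x, ideal_gen S x -> ideal_gen T x.
Proof.
move=> ST; apply: ideal_gen_min; first exact: ideal_gen_is_ideal.
by move=> x /ST; apply: ideal_gen_sub.
Qed.

End IdealGen.

Section LinearSpan.
Variable E : fieldType.

(** Spanning sets here are infinite and undecidable predicates. The inductive form gives proofs that
    peel off one summand of a combination at a time. *)
Inductive lspan (V : lmodType E) (S : V -> Prop) : V -> Prop :=
| lspan0 : lspan S 0
| lspanD a v x : S v -> lspan S x -> lspan S (a *: v + x).

Section Basics.
Variables (V : lmodType E) (S : V -> Prop).

Lemma lspan_sub v : S v -> lspan S v.
Proof. by move=> Sv; rewrite -[v]addr0 -[v]scale1r; apply: lspanD => //; apply: lspan0. Qed.

Lemma lspan_add x y : lspan S x -> lspan S y -> lspan S (x + y).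
Proof.
move=> Sx Sy; elim: Sx => [|a v z Sv _ IH]; first by rewrite add0r.
by rewrite -addrA; apply: lspanD.
Qed.

Lemma lspan_scale a x : lspan S x -> lspan S (a *: x).
Proof.
elim=> [|b v z Sv _ IH]; first by rewrite scaler0; apply: lspan0.
by rewrite scalerDr scalerA; apply: lspanD.
Qed.

Lemma lspan_opp x : lspan S x -> lspan S (- x).
Proof. by rewrite -scaleN1r; apply: lspan_scale. Qed.

Lemma lspan_diff x y : lspan S x -> lspan S y -> lspan S (x - y).
Proof. by move=> Sx Sy; apply: lspan_add => //; apply: lspan_opp. Qed.

Lemma lspan_sum (T : Type) (r : seq T) (P : pred T) (f : T -> V) :
  (forall t, P t -> lspan S (f t)) -> lspan S (\sum_(t <- r | P t) f t).
Proof. by move=> Sf; apply: big_ind => //; [apply: lspan0 | apply: lspan_add]. Qed.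

End Basics.

Lemma linear_fun0 (V W : lmodType E) (f : V -> W) : linear f -> f 0 = 0.
Proof. by move=> lf; have := lf (-1) 0 0; rewrite scaler0 addr0 scaleN1r addNr. Qed.

Lemma lspan_map (V W : lmodType E) (f : V -> W) (S : V -> Prop) (T : W -> Prop) x :
  linear f -> (forall v, S v -> lspan T (f v)) -> lspan S x -> lspan T (f x).
Proof.
move=> lf ST; elim=> [|a v y Sv _ IH]; first by rewrite linear_fun0 //; apply: lspan0.
by rewrite lf; apply: lspan_add => //; apply/lspan_scale/ST.
Qed.

Lemma lspan_mono (V : lmodType E) (S T : V -> Prop) x :
  (forall v, S v -> T v) -> lspan S x -> lspan T x.
Proof. by move=> ST; apply: (@lspan_map _ _ id) => // v /ST; apply: lspan_sub. Qed.

(** The coefficients of a combination of the [f u] are reused on the [g u]. This records the value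
    of a functional along a reduction. *)
Lemma lspan_lift (U : Type) (V W : lmodType E) (P : U -> Prop) (f : U -> V)
    (g : U -> W) x : lspan (fun v => exists2 u, P u & v = f u) x ->
  exists y, lspan (fun vw => exists2 u, P u & vw = (f u, g u)) (x, y).
Proof.
elim=> [|a _ z [u Pu ->] _ [y IH]]; first by exists 0; apply: lspan0.
exists (a *: g u + y).
have -> : (a *: f u + z, a *: g u + y) = a *: (f u, g u) + (z, y) by [].
by apply: lspanD => //; exists u.
Qed.

End LinearSpan.

Section Monomials.
Variable n : nat.
Implicit Types m : 'X_{1..n}.

Lemma submm m : (m - m = 0)%MM.
Proof. by rewrite -{1}[m]add0m addmK. Qed.

Lemma mnm_split m k : (k <= mdeg m)%N -> exists m1 m2, m = (m1 + m2)%MM /\ mdeg m1 = k.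
Proof.
elim: k => [|k IH] lt_k; first by exists 0%MM, m; rewrite add0m mdeg0.
have [m1 [m2 [em dm1]]] := IH (ltnW lt_k).
have [i m2i] : exists i, m2 i != 0%N.
  apply/existsP; apply: contraLR lt_k; rewrite negb_exists => /forallP m2_0.
  rewrite -leqNgt em mdegD dm1 -[X in (_ <= X)%N]addn0 leq_add2l leqn0 mdeg_eq0.
  by apply/eqP/mnmP=> i; rewrite mnm0E; apply/eqP; rewrite -[_ == _]negbK m2_0.
exists (m1 + U_(i))%MM, (m2 - U_(i))%MM; split.
  by rewrite -addmA [(U_(i) + _)%MM]addmC submK // lep1mP.
by rewrite mdegD mdeg1 dm1 addn1.
Qed.

Lemma mnm_splitU m : (0 < mdeg m)%N -> exists i m', m = (U_(i) + m')%MM.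
Proof.
move=> /mnm_split[m1 [m2 [-> /eqP/mdeg1P[i /eqP->]]]]; by exists i, m2.
Qed.

End Monomials.

Section Homogeneous.
Variables (n : nat) (F : fieldType).
Implicit Types (p q f g h : {mpoly F[n]}) (m : 'X_{1..n}) (I M : {mpoly F[n]} -> Prop).

Lemma dhomogPn k p : reflect (forall m, p@_m != 0 -> mdeg m = k) (p \is k.-homog).
Proof.
by apply: (iffP (dhomogP _ _ _)) => h m; have := h m; rewrite mcoeff_msupp.
Qed.

Lemma mcoeff_restrict (P : pred 'X_{1..n}) p m :
  (\sum_(m' <- msupp p | P m') p@_m' *: 'X_[m'])@_m = if P m then p@_m else 0.
Proof.
rewrite raddf_sum /= (eq_bigr (fun m' => p@_m' * (m' == m)%:R)); last first.
  by move=> m' _; rewrite mcoeffZ mcoeffX.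
have [mp|mp] := boolP (m \in msupp p); last first.
  rewrite big1_seq; first by rewrite (memN_msupp_eq0 mp) if_same.
  by move=> m' /andP[_ m'p]; case: eqP => [e|]; [rewrite -e m'p in mp | rewrite mulr0].
case: ifP => Pm.
  rewrite -big_filter (bigD1_seq m) /=; last 2 first.
  - by rewrite mem_filter Pm.
  - by rewrite filter_uniq.
  rewrite eqxx mulr1 big1 ?addr0 // => m' /negPf->; by rewrite mulr0.
rewrite big1 // => m' Pm'; case: eqP => [e|]; last by rewrite mulr0.
by rewrite -e Pm' in Pm.
Qed.

Lemma mcoeff_pihomog k p m : (pihomog mdeg k p)@_m = if mdeg m == k then p@_m else 0.
Proof. exact: mcoeff_restrict. Qed.

Lemma pihomogM_homog k l b h : h \is l.-homog ->
  pihomog mdeg k (b * h) = if (l <= k)%N then pihomog mdeg (k - l) b * h else 0.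
Proof.
move=> hl; elim/mpolyind: b => [|c m b _ _ IH].
  by rewrite !(mul0r, pihomog0) if_same.
rewrite mulrDl !pihomogD IH -scalerAl !linearZ /=.
have hXh : 'X_[m] * h \is (mdeg m + l).-homog by apply: dhomogM => //; rewrite dhomogX.
rewrite pihomogX; case: leqP => lk.
  rewrite mulrDl -scalerAl; congr (_ *: _ + _).
  have [e|ne] := eqVneq (mdeg m) (k - l)%N.
    by rewrite pihomog_dE // -(subnK lk) -e.
  rewrite mul0r (pihomog_ne0 _ hXh) //.
  by apply: contraNneq ne => <-; rewrite addnK.
rewrite (pihomog_ne0 _ hXh) ?scaler0 ?addr0 //.
by apply: contraTneq lk => <-; rewrite -leqNgt leq_addl.
Qed.

Lemma pihomog_sumE p : exists k, p = \sum_(d < k) pihomog mdeg d p.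
Proof. by exists (msize p); apply: pihomog_partitionE. Qed.

Lemma ideal_pihomog_eq (J : {mpoly F[n]} -> Prop) p : is_ideal J ->
  (forall k, J (pihomog mdeg k p)) -> J p.
Proof.
move=> idJ Jp; have [k ->] := pihomog_sumE p.
by apply: ideal_sum => // i _; apply: Jp.
Qed.

End Homogeneous.

(** * Minimal generators and generation in low degrees *)

Section MinimalGenerators.
Variables (n : nat) (F : fieldType).
Implicit Types (p q f g h : {mpoly F[n]}) (I J P : {mpoly F[n]} -> Prop).

Definition homog_below I k g := I g /\ exists2 j, (j < k)%N & g \is j.-homog.

(** Working form of the absence of a minimal generator in degree k, free of any choice of
    generators. For homogeneous ideals it is equivalent to it by [no_min_gen_no_new_gen] and
    [no_new_gen_no_min_gen]. *)
Definition no_new_gen I k :=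
  forall f, I f -> f \is k.-homog -> ideal_gen (homog_below I k) f.

Lemma ideal_scale J a p : is_ideal J -> J p -> J (a *: p).
Proof. by case=> _ _ JM Jp; rewrite -mul_mpolyC; apply: JM. Qed.

Lemma lspan_ideal J (S : {mpoly F[n]} -> Prop) p :
  is_ideal J -> (forall v, S v -> J v) -> lspan S p -> J p.
Proof.
move=> idJ SJ; case: (idJ) => J0 JD _; elim=> [|a v x Sv _ Jx] //.
by apply: JD => //; apply: ideal_scale => //; apply: SJ.
Qed.

(** Gaussian elimination along [ms]: either all of P vanishes at the first monomial, or one element
    of P that does not serves to clear this coefficient in all the others. *)
Lemma finite_span_supp (ms : seq 'X_{1..n}) P :
  P 0 -> (forall a p q, P p -> P q -> P (a *: p + q)) ->
  (forall p m, P p -> p@_m != 0 -> m \in ms) ->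
  exists s : seq {mpoly F[n]},
    (forall x, x \in s -> P x) /\ forall p, P p -> lspan (fun x => x \in s) p.
Proof.
elim: ms P => [|m ms IH] P P0 PL Pms.
  exists [::]; split=> // p Pp; suff -> : p = 0 by apply: lspan0.
  by apply/mpolyP=> m; rewrite mcoeff0; apply/eqP/negP => /negP /(Pms _ _ Pp).
pose P' p := P p /\ p@_m = 0.
have [||p m' [Pp pm0] pm'|s [sP' sspan]] := IH P'.
- by split=> //; rewrite mcoeff0.
- move=> a p q [Pp pm] [Pq qm]; split; first exact: PL.
  by rewrite mcoeffD mcoeffZ pm qm mulr0 addr0.
- by have := Pms _ _ Pp pm'; rewrite inE => /orP[/eqP e|//]; rewrite e pm0 eqxx in pm'.
case: (excluded_middle_informative (exists p, P p /\ p@_m != 0)) => [[p0 [Pp0 p0m]]|no].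
  exists (p0 :: s); split=> [x|p Pp].
    by rewrite inE => /orP[/eqP->|/sP'[]].
  have -> : p = (p@_m / p0@_m) *: p0 + ((- (p@_m / p0@_m)) *: p0 + p).
    by rewrite addrA -scalerDl subrr scale0r add0r.
  apply: lspanD; first exact: mem_head.
  apply: (@lspan_mono _ _ (fun x => x \in s)).
    by move=> v vs; rewrite inE vs orbT.
  apply: sspan; split; first exact: PL.
  by rewrite mcoeffD mcoeffZ mulNr divfK // addNr.
exists s; split=> [x /sP'[]//|p Pp]; apply: sspan; split=> //.
by apply/eqP/negP => /negP pm; apply: no; exists p.
Qed.

Lemma finite_span_homog k P :
  P 0 -> (forall a p q, P p -> P q -> P (a *: p + q)) ->
  (forall p, P p -> p \is k.-homog) ->
  exists s : seq {mpoly F[n]},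
    (forall x, x \in s -> P x) /\ forall p, P p -> lspan (fun x => x \in s) p.
Proof.
move=> P0 PL Ph; apply: (@finite_span_supp [seq val m | m : 'X_{1..n < k.+1}]) => //.
move=> p m /Ph /dhomogPn hp /hp dm.
have lt_m : (mdeg m < k.+1)%N by rewrite dm.
by apply/imageP; exists (BMultinom lt_m).
Qed.

(** As long as some element depends on D and the others, dropping it keeps the span and shortens the
    list. *)
Lemma irredundant_span (D : {mpoly F[n]} -> Prop) P (s : seq {mpoly F[n]}) :
  (forall x, x \in s -> P x) ->
  (forall p, P p -> lspan (fun x => D x \/ x \in s) p) ->
  exists t : seq {mpoly F[n]},
    [/\ forall x, x \in t -> P x,
        forall p, P p -> lspan (fun x => D x \/ x \in t) p
      & forall g, g \in t -> ~ lspan (fun x => D x \/ (x \in t /\ x <> g)) g].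
Proof.
have [k] := ubnP (size s); elim: k s => // k IH s sk sP sspan.
case: (excluded_middle_informative
  (exists2 g, g \in s & lspan (fun x => D x \/ (x \in s /\ x <> g)) g)); last first.
  by move=> no; exists s; split=> // g gs gspan; apply: no; exists g.
case=> g gs gspan; apply: (IH [seq x <- s | x != g]).
- apply: (@leq_trans (size s)); last by rewrite -ltnS.
  rewrite size_filter -(count_predC (pred1 g) s).
  by rewrite -[X in (X < _)%N]add0n ltn_add2r -has_count has_pred1.
- by move=> x; rewrite mem_filter => /andP[_ /sP].
move=> p /sspan; apply: (@lspan_map _ _ _ id) => // v [Dv|vs].
  by apply: lspan_sub; left.
have sub x : D x \/ x \in s /\ x <> g -> D x \/ x \in [seq x <- s | x != g].
  by case=> [|[xs /eqP xg]]; [left | right; rewrite mem_filter xg].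
have [->|vg] := eqVneq v g; first by apply: lspan_mono gspan.
by apply: lspan_sub; right; rewrite mem_filter vg.
Qed.

(** Representatives of a vector space basis of the degree k part of I modulo what is generated in
    lower degrees. *)
Definition degree_basis I k (s : seq {mpoly F[n]}) :=
  [/\ forall x, x \in s -> I x /\ x \is k.-homog,
      forall p, I p -> p \is k.-homog ->
        lspan (fun x => ideal_gen (homog_below I k) x \/ x \in s) p
    & forall g, g \in s ->
        ~ lspan (fun x => ideal_gen (homog_below I k) x \/ (x \in s /\ x <> g)) g].

Lemma degree_basis_exists I k : is_ideal I -> exists s, degree_basis I k s.
Proof.
move=> idI; case: (idI) => I0 ID _.
have [||p []//|s [sP sspan]] :=
    @finite_span_homog k (fun p => I p /\ p \is k.-homog).
- by split=> //; apply: dhomog0.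
- move=> a p q [Ip hp] [Iq hq]; split; last by apply: dhomogD => //; apply: dhomogZ.
  by apply: ID => //; apply: ideal_scale.
have [|t [tP tspan tirr]] :=
    @irredundant_span (ideal_gen (homog_below I k)) _ _ sP.
  by move=> p /sspan; apply: lspan_mono => x xs; right.
by exists t; split=> // p Ip hp; apply: tspan.
Qed.

(** Graded Nakayama: generation follows by strong induction on the degree, minimality from the
    irredundancy in each single degree. *)
Lemma degree_bases_minimal_gens I (s : nat -> seq {mpoly F[n]}) :
  homogeneous_ideal I -> (forall k, degree_basis I k (s k)) ->
  minimal_homog_gens I (fun g => exists k, g \in s k).
Proof.
move=> [idI Ih] sB; set G := fun g => _.
have idG := ideal_gen_is_ideal G.
split=> [g [k gk]|p|g [j gj] gen].
- by have [/(_ _ gk)[_ /homogE]] := sB k.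
- split=> [|Ip].
    apply: ideal_gen_min => // g [k gk].
    by have [/(_ _ gk)[]] := sB k.
  apply: ideal_pihomog_eq => // k.
  have: pihomog mdeg k p \is k.-homog by apply: pihomogP.
  have: I (pihomog mdeg k p) by apply: Ih.
  move: (pihomog mdeg k p) => {Ip}p.
  have [l] := ubnP k; elim: l k p => // l IH k p kl Ip hp.
  have [_ /(_ _ Ip hp) span_p _] := sB k.
  apply: (lspan_ideal idG) span_p => v [|vk]; last first.
    by apply: ideal_gen_sub; exists k.
  apply: ideal_gen_min => // q [Iq [i ik hq]].
  exact: IH (leq_trans ik kl) Iq hq.
have [sI _ sirr] := sB j; have [Ig hg] := sI _ gj.
(* Take the degree j part of a representation of g by the other generators. Those of degree below j
   contribute to the ideal generated in lower degrees, those of degree j enter with scalar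
   coefficients, those of larger degree drop out. *)
apply: (sirr _ gj); rewrite -[X in lspan _ X](pihomog_dE hg).
move: (proj2 (gen g) Ig); move: {2 4}g => q [r [rG ->]] {q}.
elim: r rG => [|[a h] r IH] rG; first by rewrite big_nil pihomog0; apply: lspan0.
rewrite big_cons pihomogD /=; apply: lspan_add; last first.
  by apply: IH => y yr; apply: rG; rewrite inE yr orbT.
have /= [[l hl] hg'] := rG _ (mem_head _ _).
have [Ih' hh] : I h /\ h \is l.-homog by have [+ _ _] := sB l; apply.
rewrite (pihomogM_homog _ _ hh).
case: ltngtP => [lj|_|lj]; last 1 first.
- rewrite lj subnn.
  have -> : pihomog mdeg 0 a = (a@_0%MM)%:MP.
    apply/mpolyP=> m; rewrite mcoeff_pihomog mcoeffC mdeg_eq0 eq_sym.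
    by case: eqP => [<-|]; rewrite ?mulr1 ?mulr0.
  rewrite mul_mpolyC; apply/lspan_scale/lspan_sub; right; split=> //.
  by rewrite -lj.
- apply: lspan_sub; left; have [_ _] := ideal_gen_is_ideal (homog_below I j).
  by apply; apply: ideal_gen_sub; split=> //; exists l.
- exact: lspan0.
Qed.

(** If f were not generated in lower degrees, the basis chosen in degree k would be non-empty, and
    any of its elements would belong to a minimal system of generators. *)
Lemma no_min_gen_no_new_gen I k : homogeneous_ideal I ->
  ~ has_min_gen_in_degree I k%:Z -> no_new_gen I k.
Proof.
move=> hI nomin f If hf.
case: (excluded_middle_informative (ideal_gen (homog_below I k) f)) => // nf.
case: nomin.
pose s j := sval (constructive_indefinite_description _
  (degree_basis_exists j (proj1 hI))).
have sB j : degree_basis I j (s j) by rewrite /s; case: constructive_indefinite_description.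
have [sI /(_ _ If hf) span_f _] := sB k.
case e : (s k) => [|g t].
  case: nf; apply: lspan_ideal span_f; first exact: ideal_gen_is_ideal.
  by move=> v; rewrite e; case.
have gk : g \in s k by rewrite e mem_head.
exists (fun g => exists k, g \in s k), g, k; split=> //.
- exact: degree_bases_minimal_gens.
- by exists k.
- by have [] := sI _ gk.
Qed.

(** After taking degree j parts, an element of I of degree j < k involves only generators of degree
    at most j, hence not g. So g, being generated by such elements, is redundant. *)
Lemma no_new_gen_no_min_gen I k : homogeneous_ideal I ->
  no_new_gen I k -> ~ has_min_gen_in_degree I k%:Z.
Proof.
move=> [idI Ih] new [G [g [k' [[Gh Ggen Gmin] Gg hg [ek]]]]]; subst k'.
apply: (Gmin _ Gg); set G' := fun h => _.
have idG' := ideal_gen_is_ideal G'.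
have GI h : G h -> I h by move=> Gh'; apply/Ggen/ideal_gen_sub.
have g_in : ideal_gen G' g.
  apply: ideal_gen_min (new _ (GI _ Gg) hg) => // q [Iq [j jk hq]].
  rewrite -(pihomog_dE hq); have /Ggen [r [rG ->]] := Iq.
  rewrite linear_sum; apply: ideal_sum => // -[a h] /rG /= Gh'.
  have /homogP[l hl] := Gh _ Gh'.
  rewrite (pihomogM_homog _ _ hl); case: leqP => [lj|_]; last by case: idG'.
  have [e|hg'] := eqVneq h g.
    (* The zero polynomial is homogeneous of every degree, so the degree argument needs g to be
       non-zero. *)
    subst h; have [->|g0] := eqVneq g 0; first by rewrite mulr0; case: idG'.
    have ekl := dhomog_uniq g0 hg hl.
    by move: jk; rewrite ekl ltnNge lj.
  by case: idG' => _ _; apply; apply: ideal_gen_sub; split=> //; apply/eqP.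
move=> p; split=> [|/Ggen].
  by apply: ideal_gen_min => // h [/GI].
apply: ideal_gen_min => // h Gh'.
have [->//|/eqP hg'] := eqVneq h g.
by apply: ideal_gen_sub.
Qed.

End MinimalGenerators.

(** * Groebner bases in a single degree and linear syzygies *)

Section InitialMonomials.
Variables (n : nat) (le : rel 'X_{1..n}).
Hypothesis hle : monomial_order le.
Implicit Types m : 'X_{1..n}.

Lemma mo_refl m : le m m.
Proof. by case: hle => _ _ tot _ _; have := tot m m; rewrite orbb. Qed.

Lemma mo_trans m2 m1 m3 : le m1 m2 -> le m2 m3 -> le m1 m3.
Proof. by case: hle => _ tr _ _ _; apply: tr. Qed.

Lemma mo_anti m1 m2 : le m1 m2 -> le m2 m1 -> m1 = m2.
Proof. by case: hle => an _ _ _ _ h1 h2; apply: an; rewrite h1. Qed.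

Lemma mo_add m m1 m2 : le (m + m1)%MM (m + m2)%MM = le m1 m2.
Proof.
case: hle => _ _ tot _ add; apply/idP/idP; last exact: add.
move=> h; have /orP[//|/(add m) h'] := tot m1 m2.
by have /addmI-> := mo_anti h h'; apply: mo_refl.
Qed.

Definition mlt m1 m2 := le m1 m2 && (m1 != m2).

Lemma mlt_add m m1 m2 : mlt (m + m1)%MM (m + m2)%MM = mlt m1 m2.
Proof. by rewrite /mlt mo_add eqm_add2l. Qed.

Lemma mlt_le m1 m2 : mlt m1 m2 -> le m1 m2.
Proof. by case/andP. Qed.

Lemma le_mlt_trans m2 m1 m3 : le m1 m2 -> mlt m2 m3 -> mlt m1 m3.
Proof.
move=> h12 /andP[h23 ne]; rewrite /mlt (mo_trans h12 h23) /=.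
by apply: contraNneq ne => e; apply/eqP/mo_anti => //; rewrite -e.
Qed.

Lemma max_in_seq (s : seq 'X_{1..n}) m0 : m0 \in s ->
  exists2 m, m \in s & forall m', m' \in s -> le m' m.
Proof.
elim: s m0 => // a s IH m0 _; case: s IH => [_|b s IH].
  by exists a; rewrite ?mem_head // => m'; rewrite inE => /eqP->; apply: mo_refl.
have [m ms mmax] := IH b (mem_head _ _).
case: (hle) => _ _ tot _ _; have /orP[am|ma] := tot a m.
  exists m; first by rewrite inE ms orbT.
  by move=> m'; rewrite inE => /orP[/eqP->//|/mmax].
exists a; first exact: mem_head.
move=> m'; rewrite inE => /orP[/eqP->|/mmax h]; first exact: mo_refl.
exact: mo_trans h ma.
Qed.

(** Only finitely many monomials have degree at most k, so the number of those below m is a rank for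
    the induction. *)
Lemma mo_ind k (P : 'X_{1..n} -> Prop) :
  (forall m, mdeg m = k -> (forall m', mdeg m' = k -> mlt m' m -> P m') -> P m) ->
  forall m, mdeg m = k -> P m.
Proof.
move=> step.
pose rank m := #|[set m' : 'X_{1..n < k.+1} | mlt m' m]|.
move=> m; have [r] := ubnP (rank m); elim: r m => // r IH m rm dm.
apply: step => // m' dm' lt_m'; apply: (IH) => //.
apply: leq_trans (ltnSE rm); apply: proper_card.
apply/properP; split.
  apply/subsetP=> x; rewrite !inE => /mlt_le h.
  exact: le_mlt_trans h lt_m'.
have lt_k : (mdeg m' < k.+1)%N by rewrite dm'.
by exists (BMultinom lt_k); rewrite !inE //= /mlt eqxx andbF.
Qed.

Variable E : fieldType.
Implicit Types (p q f g h : {mpoly E[n]}) (M : {mpoly E[n]} -> Prop).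

Lemma initial_exists p : p != 0 -> exists m, initial_monomial le p m.
Proof.
move=> p0; have [|m mp mmax] := @max_in_seq (msupp p) (mlead p).
  exact: mlead_supp.
by exists m.
Qed.

Definition init_mon M m := exists2 p, M p & initial_monomial le p m.

(** The component of p in the degree of m still has initial monomial m; dividing by its leading
    coefficient makes it monic. *)
Lemma init_mon_homog M m : homogeneous_ideal M -> init_mon M m ->
  exists p, [/\ M p, p \is (mdeg m).-homog, initial_monomial le p m & p@_m = 1].
Proof.
move=> [idM hM] [p Mp [mp mmax]].
have pm0 : p@_m != 0 by rewrite -mcoeff_msupp.
exists ((p@_m)^-1 *: pihomog mdeg (mdeg m) p).
have cf m' : ((p@_m)^-1 *: pihomog mdeg (mdeg m) p)@_m' =
    if mdeg m' == mdeg m then p@_m' / p@_m else 0.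
  by rewrite mcoeffZ mcoeff_pihomog mulrC; case: ifP => // _; rewrite mul0r.
split.
- by apply: ideal_scale => //; apply: hM.
- by apply/dhomogZ/pihomogP.
- split; first by rewrite mcoeff_msupp cf eqxx divff ?oner_eq0.
  move=> m'; rewrite mcoeff_msupp cf; case: ifP => _; last by rewrite eqxx.
  by move=> h; apply: mmax; rewrite mcoeff_msupp; apply: contraNneq h => ->; rewrite mul0r.
- by rewrite cf eqxx divff.
Qed.

Lemma init_mon_mul M m u : is_ideal M -> init_mon M m -> init_mon M (u + m)%MM.
Proof.
move=> [_ _ idM] [p Mp [mp mmax]]; exists ('X_[u] * p); first exact: idM.
have supp m' : (m' \in msupp ('X_[u] * p)) = (m' \in [seq (u + m'')%MM | m'' <- msupp p]).
  by rewrite mulrC; apply/perm_mem/msuppMX.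
split; first by rewrite supp map_f.
by move=> m'; rewrite supp => /mapP[m'' /mmax h ->]; rewrite mo_add.
Qed.

(** Division in degree j: a scalar multiple of some h in S with the same initial monomial as p
    cancels that monomial, and the remainder has a smaller one. The bound by m0 makes the result a
    standard representation. *)
Lemma reduction M j (S : {mpoly E[n]} -> Prop) p m0 :
  homogeneous_ideal M ->
  (forall m, init_mon M m -> mdeg m = j ->
     exists h, [/\ S h, M h, h \is j.-homog & initial_monomial le h m]) ->
  M p -> p \is j.-homog -> (forall m, m \in msupp p -> le m m0) ->
  lspan (fun h => S h /\ exists2 m, le m m0 & initial_monomial le h m) p.
Proof.
move=> [[M0 MD MM] hM] hS Mp hp pm0.
have [->|p0] := eqVneq p 0; first exact: lspan0.
have [m pm] := initial_exists p0.
have dm : mdeg m = j by have /dhomogP h := hp; apply: h; case: pm.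
have mm0 : le m m0 by apply: pm0; case: pm.
move: m dm p Mp hp pm mm0 {pm0 p0}; apply: mo_ind => m dm IH p Mp hp pm mm0.
have [|h [Sh Mh hh hm]] := hS m _ dm; first by exists p.
pose a := p@_m / h@_m; pose q := (- a) *: h + p.
have -> : p = a *: h + q by rewrite addrA scaleNr subrr add0r.
apply: lspanD; first by split=> //; exists m.
have Mq : M q by apply: MD => //; rewrite -mul_mpolyC; apply: MM.
have hq : q \is j.-homog by apply: dhomogD => //; apply: dhomogZ.
have hm0 : h@_m != 0 by rewrite -mcoeff_msupp; case: hm.
have [->|q0] := eqVneq q 0; first exact: lspan0.
have [m' qm'] := initial_exists q0.
have dm' : mdeg m' = j by have /dhomogP h' := hq; apply: h'; case: qm'.
have lt_m' : mlt m' m.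
  case: qm' => m'q _; apply/andP; split.
    have := msuppD_le m'q; rewrite mem_cat => /orP[/msuppZ_le|].
      by case: hm => _; apply.
    by case: pm => _; apply.
  apply: contraTneq m'q => ->; rewrite -mcoeff_eq0 mcoeffD mcoeffZ.
  by rewrite mulNr divfK // addNr.
exact: (IH m' dm' lt_m' q Mq hq qm' (mo_trans (mlt_le lt_m') mm0)).
Qed.

End InitialMonomials.

Definition mnm_edge n (C : 'X_{1..n} -> Prop) (m c c' : 'X_{1..n}) :=
  [/\ C c, C c', (c <= m)%MM, (c' <= m)%MM & exists i j, (U_(i) + c = U_(j) + c')%MM].

Definition mnm_connected n (C : 'X_{1..n} -> Prop) :=
  forall m c c', C c -> C c' -> (c <= m)%MM -> (c' <= m)%MM ->
  clos_refl_sym_trans _ (mnm_edge C m) c c'.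

Section LinearSyzygies.
Variables (n : nat) (le : rel 'X_{1..n}).
Hypothesis hle : monomial_order le.
Variables (E : fieldType) (M : {mpoly E[n]} -> Prop) (e : nat).
Hypothesis hM : homogeneous_ideal M.

Local Notation A := {mpoly E[n]}.
Definition init_deg m := init_mon le M m /\ mdeg m = e.
Local Notation C := init_deg.

Hypothesis next_degree : forall w, init_mon le M w -> mdeg w = e.+1 ->
  exists i c, C c /\ w = (U_(i) + c)%MM.
Hypothesis connected : mnm_connected C.

Variable f : 'X_{1..n} -> A.
Hypothesis fP : forall c, C c ->
  [/\ M (f c), f c \is e.-homog, initial_monomial le (f c) c & (f c)@_c = 1].

(* That syzygies of the degree e part of M are generated by the linear ones is
   tested on bilinear functionals: each Phi that kills the multiples of linear
   syzygies kills all syzygies.  This form does not depend on a choice of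
   generators, hence survives a change of coordinates. *)
Variable Phi : A -> A -> E.
Hypothesis Phi_l : forall v, linear (fun u => Phi u v : E^o).
Hypothesis Phi_r : forall u, linear (fun v => Phi u v : E^o).
Hypothesis Phi_lin_syz : forall u z,
  lspan (fun y : (A * E^o)%type => exists l v,
    [/\ l \is 1.-homog, M v, v \is e.-homog & y = (l * v, Phi (u * l) v)]) (0, z) ->
  z = 0.

(** A combination of terms whose first component is 0 is a syzygy; its second component is then the
    value of [Phi] on this syzygy. *)
Definition term (u c : 'X_{1..n}) : (A * E^o)%type :=
  ('X_[u] * f c, Phi 'X_[u] (f c)).

Definition term_span k (P : 'X_{1..n} -> Prop) : (A * E^o)%type -> Prop :=
  lspan (fun y => exists u c, [/\ C c, mdeg u = k, P (u + c)%MM & y = term u c]).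

Lemma term_initial u c : C c -> initial_monomial le ('X_[u] * f c) (u + c)%MM.
Proof.
move=> /fP[_ _ [cf cmax] _].
have supp m' : (m' \in msupp ('X_[u] * f c)) = (m' \in [seq (u + m'')%MM | m'' <- msupp (f c)]).
  by rewrite mulrC; apply/perm_mem/msuppMX.
split; first by rewrite supp map_f.
by move=> m'; rewrite supp => /mapP[m'' /cmax h ->]; rewrite mo_add.
Qed.

(* The S-pair X_i f_c - X_j f_c' has degree e + 1, so it reduces to 0 through
   next_degree; the resulting linear syzygy is then multiplied by m / (X_i c). *)
Lemma edge_span k m c c' : mdeg m = (k + e)%N -> mnm_edge C m c c' ->
  term_span k (mlt le ^~ m) (term (m - c) c - term (m - c') c').
Proof.
move=> dm [Cc Cc' cm c'm [i [j ew]]].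
have [eij|nij] := eqVneq i j.
  move: ew; rewrite eij => /addmI ->; rewrite subrr; exact: lspan0.
set w := (U_(i) + c)%MM in ew.
(* As i and j differ, w is the least common multiple of c and c'. *)
have wm : (w <= m)%MM.
  apply/mnm_lepP=> x; have [<-|ne] := eqVneq i x.
    rewrite ew mnmDE mnm1E eq_sym (negPf nij) add0n.
    by move/mnm_lepP: c'm.
  by rewrite /w mnmDE mnm1E (negPf ne) add0n; move/mnm_lepP: cm.
pose q := (m - w)%MM.
have mq : m = (q + w)%MM by rewrite submK.
have mc : (m - c)%MM = (q + U_(i))%MM by rewrite mq /w addmA addmK.
have mc' : (m - c')%MM = (q + U_(j))%MM by rewrite mq ew addmA addmK.
have [Mfc hfc [fc_c fc_max] fc1] := fP Cc.
have [Mfc' hfc' [fc'_c' fc'_max] fc'1] := fP Cc'.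
pose p := 'X_i * f c - 'X_j * f c' : A.
case: (hM) => [[M0 MD MM] _].
have Mp : M p by apply: MD; [|rewrite -mulNr]; apply: MM.
have hp : p \is e.+1.-homog.
  by apply: rpredB; rewrite -add1n; apply: dhomogM; rewrite // dhomogX /= mdeg1.
(* Both products are monic with initial monomial w, so w cancels in p. *)
have pw m' : m' \in msupp p -> mlt le m' w.
  move=> m'p; apply/andP; split.
    have := msuppB_le m'p; rewrite mem_cat => /orP[] h.
      by have [_] := term_initial U_(i) Cc; apply.
    by rewrite ew; have [_] := term_initial U_(j) Cc'; apply.
  apply: contraTneq m'p => ->; rewrite -mcoeff_eq0 mcoeffB.
  have -> : ('X_i * f c)@_w = 1 by rewrite /w mulrC mcoeffMX.
  have -> : ('X_j * f c')@_w = 1 by rewrite ew mulrC mcoeffMX.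
  by rewrite subrr.
pose P (lc : 'I_n * 'X_{1..n}) := C lc.2 /\ mlt le (U_(lc.1) + lc.2)%MM w.
have span_p : lspan (fun v => exists2 lc, P lc & v = 'X_(lc.1) * f lc.2) p.
  have [->|p0] := eqVneq p 0; first exact: lspan0.
  have [m0 [m0p m0max]] := initial_exists hle p0.
  pose S h := exists l c0, C c0 /\ h = 'X_l * f c0 :> A.
  apply: (lspan_mono _ (reduction (S := S) hle hM _ Mp hp m0max)).
    move=> v [[l [c0 [Cc0 ->]]] [m1 m1m0 m1v]]; exists (l, c0) => //; split=> //=.
    have -> : (U_(l) + c0)%MM = m1.
      have [h1 h2] := term_initial U_(l) Cc0; case: m1v => h3 h4.
      by apply: mo_anti; [exact: hle|apply: h4|apply: h2].
    by apply: le_mlt_trans (pw _ m0p).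
  move=> m1 im1 dm1; have [l [c0 [Cc0 em1]]] := next_degree im1 dm1.
  exists ('X_l * f c0); have [? ? _ _] := fP Cc0; split.
  - by exists l, c0.
  - exact: MM.
  - by rewrite -add1n; apply: dhomogM; rewrite // dhomogX /= mdeg1.
  - by rewrite em1; apply: term_initial.
have [z1 span_z1] := lspan_lift (W := E^o)
  (fun lc : 'I_n * 'X_{1..n} => Phi ('X_[q] * 'X_(lc.1)) (f lc.2)) span_p.
pose z0 := Phi ('X_[q] * 'X_i) (f c) - Phi ('X_[q] * 'X_j) (f c').
(* The S-pair minus its reduction is a linear syzygy; [Phi], applied after multiplication by q,
   kills it. *)
have ez : z0 = z1.
  apply/eqP; rewrite -subr_eq0; apply/eqP.
  apply: (Phi_lin_syz (u := 'X_[q])).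
  have -> : (0 : A, (z0 - z1) : E^o) = (p, z0 : E^o) - (p, z1 : E^o).
    by congr pair; rewrite subrr.
  apply: lspan_diff; last first.
    apply: lspan_mono span_z1 => _ [[l c0] [/= Cc0 _] ->].
    exists 'X_l, (f c0); have [? ? _ _] := fP Cc0; split=> //.
    by rewrite dhomogX /= mdeg1.
  have -> : (p, z0 : E^o) =
    ('X_i * f c, Phi ('X_[q] * 'X_i) (f c) : E^o) -
    ('X_j * f c', Phi ('X_[q] * 'X_j) (f c') : E^o) by [].
  apply: lspan_diff; apply: lspan_sub.
    by exists 'X_i, (f c); split=> //; rewrite dhomogX /= mdeg1.
  by exists 'X_j, (f c'); split=> //; rewrite dhomogX /= mdeg1.
have -> : term (m - c) c - term (m - c') c' = ('X_[q] * p, z1 : E^o).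
  rewrite /term mc mc' !mpolyXD -ez /p mulrBr !mulrA; by [].
apply: (lspan_map (f := fun y : (A * E^o)%type => ('X_[q] * y.1, y.2) : (A * E^o)%type)) span_z1.
  by move=> a y y' /=; congr pair; rewrite mulrDr -scalerAr.
move=> _ [[l c0] [/= Cc0 lw] ->] /=; apply: lspan_sub.
exists (q + U_(l))%MM, c0; split=> //.
- move/eqP: dm; rewrite mq !mdegD !mdeg1; case: Cc => _ ->; case: Cc0 => _ dc0.
  by rewrite add1n addnS -addSn eqn_add2r addn1 => /eqP.
- by rewrite mq -addmA mlt_add.
- by rewrite /term mpolyXD mulrA.
Qed.

(** The differences telescope along a path of edges; this is where connectedness enters. *)
Lemma path_span k m c c' : mdeg m = (k + e)%N -> C c -> C c' ->
  (c <= m)%MM -> (c' <= m)%MM ->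
  term_span k (mlt le ^~ m) (term (m - c) c - term (m - c') c').
Proof.
move=> dm Cc Cc' cm c'm.
elim: (connected Cc Cc' cm c'm) => {c c' Cc Cc' cm c'm}.
- by move=> c c'; apply: edge_span.
- by move=> c; rewrite subrr; apply: lspan0.
- by move=> c c' _ IH; rewrite -opprB; apply: lspan_opp.
- move=> c c1 c' _ IH1 _ IH2; rewrite -[X in X - _](subrK (term (m - c1) c1)).
  by rewrite -addrA; apply: lspan_add.
Qed.

(** By [path_span], all terms with initial monomial m can be merged into one multiple a of a single
    such term, modulo smaller terms. As the basis is monic, a is the coefficient of m in [y.1],
    which is 0. *)
Lemma term_span_step k m y : mdeg m = (k + e)%N ->
  term_span k (le ^~ m) y -> (y.1)@_m = 0 -> term_span k (mlt le ^~ m) y.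
Proof.
move=> dm span_y ym.
have small z : term_span k (mlt le ^~ m) z -> z.1@_m = 0.
  elim=> [|a _ z0 [u [c [Cc _ lt_m ->]]] _ IH]; first by rewrite mcoeff0.
  rewrite mcoeffD mcoeffZ IH addr0; apply/eqP; rewrite mulf_eq0; apply/orP; right.
  rewrite mcoeff_eq0; apply/negP => h; have [_ /(_ _ h) h'] := term_initial u Cc.
  by case/andP: lt_m => h1; rewrite (mo_anti hle h1 h') eqxx.
have: term_span k (mlt le ^~ m) y \/ exists c a,
    [/\ C c, (c <= m)%MM & term_span k (mlt le ^~ m) (y - a *: term (m - c) c)].
  elim: span_y {ym} => [|a _ z [u [c [Cc du le_m ->]]] _ IH]; first by left; apply: lspan0.
  have [em|ne] := eqVneq (u + c)%MM m; last first.
    have sp : term_span k (mlt le ^~ m) (a *: term u c).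
      by apply/lspan_scale/lspan_sub; exists u, c; split=> //; rewrite /mlt le_m.
    case: IH => [IH|[c0 [b [Cc0 c0m IH]]]]; first by left; apply: lspan_add.
    by right; exists c0, b; split=> //; rewrite -addrA; apply: lspan_add.
  have um : u = (m - c)%MM by rewrite -em addmK.
  have cm : (c <= m)%MM by rewrite -em lem_addl.
  right; case: IH => [IH|[c0 [b [Cc0 c0m IH]]]].
    by exists c, a; split=> //; rewrite um addrAC subrr add0r.
  exists c0, (a + b); split=> //; rewrite scalerDl opprD addrACA; apply: lspan_add => //.
  rewrite um -scalerBr; apply: lspan_scale; exact: path_span.
case=> // -[c [a [Cc cm span_y']]].
have := small _ span_y'; rewrite mcoeffB ym sub0r mcoeffZ /= ['X_[_] * _]mulrC.
rewrite -[X in mcoeff X _](submK cm) mcoeffMX; have [_ _ _ ->] := fP Cc.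
rewrite mulr1 => /eqP; rewrite oppr_eq0 => /eqP a0.
by move: span_y'; rewrite a0 scale0r subr0.
Qed.

Lemma term_span_max k P y : term_span k P y -> y = 0 \/
  exists m, [/\ P m, mdeg m = (k + e)%N & term_span k (le ^~ m) y].
Proof.
elim=> [|a _ z [u [c [Cc du Pm ->]]] _ IH]; first by left.
right; have dm : mdeg (u + c)%MM = (k + e)%N by rewrite mdegD du; case: Cc => _ ->.
have sp m : le (u + c)%MM m -> term_span k (le ^~ m) (a *: term u c).
  by move=> h; apply/lspan_scale/lspan_sub; exists u, c.
case: IH => [->|[m [Pm' dm' spz]]].
  exists (u + c)%MM; split=> //; rewrite addr0; apply: sp; exact: mo_refl.
have [_ _ tot _ _] := hle; have /orP[h|h] := tot (u + c)%MM m.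
  by exists m; split=> //; apply: lspan_add => //; apply: sp.
exists (u + c)%MM; split=> //; apply: lspan_add; first exact/sp/mo_refl.
apply: lspan_mono spz => _ [u' [c' [Cc' du' h' ->]]]; exists u', c'; split=> //.
exact: mo_trans h' h.
Qed.

(** Buchberger's criterion: lowering the largest initial monomial until it occurs in [y.1] produces
    a standard representation, or shows y = 0 including its second component. *)
Lemma term_span_reduce k y : term_span k (fun=> True) y ->
  y = 0 \/ exists m, [/\ m \in msupp y.1 & term_span k (le ^~ m) y].
Proof.
case/term_span_max => [|[m [_ dm]]]; first by left.
move: m dm y; apply: (mo_ind hle) => m dm IH y spy.
have [ms|ms] := boolP (m \in msupp y.1); first by right; exists m.
have /term_span_max [|[m' [lt_m' dm' spy']]] :=
  term_span_step dm spy (memN_msupp_eq0 ms); first by left.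
exact: IH dm' lt_m' _ spy'.
Qed.

Lemma term_span_syz k z : term_span k (fun=> True) (0, z) -> z = 0.
Proof.
case/term_span_reduce => [[]//|[m []]]; by rewrite msupp0.
Qed.

(** In a standard representation no term exceeds the initial monomial m of the sum, so m must be the
    initial monomial of one of the terms. *)
Lemma term_span_initial k y m : term_span k (fun=> True) y ->
  initial_monomial le y.1 m -> exists2 c, C c & (c <= m)%MM.
Proof.
move=> /term_span_reduce [->|[m' [m's spy]]] [ms mmax]; first by rewrite msupp0 in ms.
have le_m'm := mmax _ m's.
suff [u [c [Cc h1 h2]]] : exists u c, [/\ C c, le (u + c)%MM m' & le m (u + c)%MM].
  by exists c => //; rewrite (mo_anti hle h2 (mo_trans hle h1 le_m'm)) lem_addl.
elim: spy ms => [|a _ z [u [c [Cc du h ->]]] _ IH]; first by rewrite msupp0.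
move=> /msuppD_le; rewrite mem_cat => /orP[/msuppZ_le/= hm|]; last exact: IH.
by exists u, c; split=> //; have [_] := term_initial u Cc; apply.
Qed.

Lemma term_span_homog k u v : u \is k.-homog -> M v -> v \is e.-homog ->
  term_span k (fun=> True) (u * v, Phi u v : E^o).
Proof.
move=> hu Mv hv.
have [->|v0] := eqVneq v 0.
  have -> : Phi u 0 = 0 by have := Phi_r u (-1) 0 0; rewrite scaler0 addr0 scaleN1r addNr.
  by rewrite mulr0; apply: lspan0.
have [m0 [_ m0max]] := initial_exists hle v0.
have spv : lspan (fun h => exists2 c, C c & h = f c) v.
  apply: (lspan_mono _ (reduction (S := fun h => exists2 c, C c & h = f c) hle hM _ Mv hv m0max)).
    by move=> ? [].
  move=> m im dm; have Cm : C m by split.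
  by have [? ? ? _] := fP Cm; exists (f m); split=> //; exists m.
apply: (lspan_map (f := fun v => (u * v, Phi u v) : (A * E^o)%type)) spv.
  by move=> a x y; congr pair; [rewrite mulrDr -scalerAr | apply: Phi_r].
move=> _ [c Cc ->].
have -> : u = \sum_(m <- msupp u | mdeg m == k) u@_m *: 'X_[m].
  by rewrite -[LHS](pihomog_dE hu).
apply: (big_ind (fun u => term_span k (fun=> True) (u * f c, Phi u (f c) : E^o))).
- have -> : Phi 0 (f c) = 0 by have := Phi_l (f c) (-1) 0 0; rewrite scaler0 addr0 scaleN1r addNr.
  by rewrite mul0r; apply: lspan0.
- move=> x y hx hy; rewrite mulrDl.
  have -> : Phi (x + y) (f c) = Phi x (f c) + Phi y (f c).
    by have := Phi_l (f c) 1 x y; rewrite !scale1r.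
  exact: (lspan_add hx hy).
- move=> m /eqP dm; rewrite -scalerAl.
  have -> : Phi (u@_m *: 'X_[m]) (f c) = u@_m *: (Phi 'X_[m] (f c) : E^o).
    have := Phi_l (f c) u@_m 'X_[m] 0; rewrite !addr0 => ->.
    have -> : Phi 0 (f c) = 0 by have := Phi_l (f c) (-1) 0 0; rewrite scaler0 addr0 scaleN1r addNr.
    by rewrite addr0.
  apply: (@lspan_scale _ _ _ u@_m (term m c)); apply: lspan_sub.
  by exists m, c.
Qed.

End LinearSyzygies.

Section LowDegreeGenerators.
Variables (n : nat) (E : fieldType) (M : {mpoly E[n]} -> Prop) (e : nat).
Hypothesis hM : homogeneous_ideal M.
Local Notation A := {mpoly E[n]}.

(** A generator h has degree j <= e. A monomial of degree k + e - j in its coefficient splits into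
    degrees k and e - j, and the second factor is absorbed into h. *)
Lemma homog_below_span k p : ideal_gen (homog_below M e.+1) p ->
  lspan (fun y => exists u v, [/\ u \is k.-homog, M v, v \is e.-homog & y = u * v])
    (pihomog mdeg (k + e) p).
Proof.
case: (hM) => [[_ _ MM] _].
case=> r [rM ->]; elim: r rM => [|[a h] r IH] rM; first by rewrite big_nil pihomog0; apply: lspan0.
rewrite big_cons pihomogD /=; apply: lspan_add; last first.
  by apply: IH => y yr; apply: rM; rewrite inE yr orbT.
have /= [Mh [j je hj]] := rM _ (mem_head _ _).
rewrite (pihomogM_homog _ _ hj); case: leqP => _; last exact: lspan0.
rewrite pihomogE mulr_suml; apply: lspan_sum => m /eqP/= dm.
have [m1 [m2 [em dm1]]] : exists m1 m2, m = (m1 + m2)%MM /\ mdeg m1 = k.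
  by apply: mnm_split; rewrite dm -addnBA // leq_addr.
rewrite -scalerAl em mpolyXD -mulrA; apply/lspan_scale/lspan_sub.
exists 'X_[m1], ('X_[m2] * h); split=> //.
- by rewrite dhomogX; apply/eqP.
- exact: MM.
- have -> : e = (mdeg m2 + j)%N; last by apply: dhomogM; rewrite // dhomogX.
  move: dm; rewrite em mdegD dm1 -addnBA // => /eqP; rewrite eqn_add2l => /eqP ->.
  by rewrite subnK.
Qed.

Lemma no_new_gen_below : (forall k, (e < k)%N -> no_new_gen M k) ->
  forall p, M p -> ideal_gen (homog_below M e.+1) p.
Proof.
case: hM => idM hom new p Mp.
have idG := ideal_gen_is_ideal (homog_below M e.+1).
apply: ideal_pihomog_eq => // k.
have: pihomog mdeg k p \is k.-homog by apply: pihomogP.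
have: M (pihomog mdeg k p) by apply: hom.
move: (pihomog mdeg k p) => {Mp}p.
have [l] := ubnP k; elim: l k p => // l IH k p kl Mp hp.
case: (leqP k e) => ke; first by apply: ideal_gen_sub; split=> //; exists k.
apply: ideal_gen_min (new _ ke _ Mp hp) => // q [Mq [i ik hq]].
exact: (IH i q (leq_trans ik kl) Mq hq).
Qed.

End LowDegreeGenerators.

Section GroebnerConsequences.
Variables (n : nat) (le : rel 'X_{1..n}).
Hypothesis hle : monomial_order le.
Variables (E : fieldType) (M : {mpoly E[n]} -> Prop) (e : nat).
Hypothesis hM : homogeneous_ideal M.
Local Notation A := {mpoly E[n]}.
Local Notation C := (init_deg le M e).
Hypothesis next_degree : forall w, init_mon le M w -> mdeg w = e.+1 ->
  exists i c, C c /\ w = (U_(i) + c)%MM.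
Hypothesis connected : mnm_connected C.

Lemma monic_initial_family : exists f : 'X_{1..n} -> A, forall c, C c ->
  [/\ M (f c), f c \is e.-homog, initial_monomial le (f c) c & (f c)@_c = 1].
Proof.
have ex c : exists fc : A, C c ->
    [/\ M fc, fc \is e.-homog, initial_monomial le fc c & fc@_c = 1].
  case: (excluded_middle_informative (C c)) => [[ic dc]|nC]; last by exists 0 => /nC.
  by have [p] := init_mon_homog hM ic; rewrite dc; exists p.
exists (fun c => sval (constructive_indefinite_description _ (ex c))) => c.
by case: constructive_indefinite_description.
Qed.

(** Expanding each v in the Groebner basis and each u in monomials turns an arbitrary syzygy into
    one between terms, where [term_span_syz] applies. *)
Lemma linear_syzygies_generate (Phi : A -> A -> E) :
  (forall v, linear (fun u => Phi u v : E^o)) ->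
  (forall u, linear (fun v => Phi u v : E^o)) ->
  (forall u z, lspan (fun y : (A * E^o)%type => exists l v,
      [/\ l \is 1.-homog, M v, v \is e.-homog & y = (l * v, Phi (u * l) v)]) (0, z) ->
    z = 0) ->
  forall k z, lspan (fun y : (A * E^o)%type => exists u v,
      [/\ u \is k.-homog, M v, v \is e.-homog & y = (u * v, Phi u v)]) (0, z) ->
    z = 0.
Proof.
move=> Pl Pr Psyz k z span_z; have [f fP] := monic_initial_family.
apply: (term_span_syz (k := k) hle hM next_degree connected fP Psyz).
apply: (lspan_map (f := id)) span_z => // _ [u [v [hu Mv hv ->]]].
exact: term_span_homog.
Qed.

(** The instance [Phi] = 0 of the reduction: only first components matter, and generation in degrees
    at most e makes every homogeneous element of degree at least e a combination of terms. *)
Lemma initial_generated : (forall p, M p -> ideal_gen (homog_below M e.+1) p) ->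
  forall m, init_mon le M m -> (e <= mdeg m)%N -> exists2 c, C c & (c <= m)%MM.
Proof.
move=> gen m /(init_mon_homog hM)[p [Mp hp pm _]] em.
have [f fP] := monic_initial_family.
have lin0 : linear (fun _ : A => 0 : E^o) by move=> a x y /=; rewrite scaler0 addr0.
have Psyz (u : A) (z : E^o) : lspan (fun y : (A * E^o)%type => exists l v,
    [/\ l \is 1.-homog, M v, v \is e.-homog & y = (l * v, 0)]) (0, z) -> z = 0.
  suff gen0 y : lspan (fun y : (A * E^o)%type => exists l v,
    [/\ l \is 1.-homog, M v, v \is e.-homog & y = (l * v, 0)]) y -> y.2 = 0.
    by move/gen0.
  by elim=> [|a _ x [l [v [_ _ _ ->]]] _ /= ->] //=; rewrite scaler0 addr0.
suff span_p : term_span le M e f (fun _ _ => 0) (mdeg m - e) (fun=> True) (p, 0 : E^o).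
  by have := term_span_initial hle hM next_degree connected fP Psyz span_p pm.
have := homog_below_span hM (mdeg m - e) (gen _ Mp).
rewrite subnK // pihomog_dE //.
apply: (lspan_map (f := fun x : A => (x, 0 : E^o))).
  by move=> a x y; congr pair; rewrite /= scaler0 addr0.
move=> _ [u [v [hu Mv hv ->]]].
exact: (@term_span_homog _ _ hle _ _ _ hM f fP (fun _ _ => 0)
  (fun _ => lin0) (fun _ => lin0)).
Qed.

Lemma next_degree_span p : M p -> p \is e.+1.-homog ->
  lspan (fun y => exists l v, [/\ l \is 1.-homog, M v, v \is e.-homog & y = l * v]) p.
Proof.
move=> Mp hp; have [f fP] := monic_initial_family.
have [->|p0] := eqVneq p 0; first exact: lspan0.
have [m0 [m0p m0max]] := initial_exists hle p0.
case: (hM) => [[_ _ MM] _].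
apply: (lspan_mono _ (reduction (S := fun h => exists l c, C c /\ h = 'X_l * f c)
  hle hM _ Mp hp m0max)).
  move=> _ [[l [c [Cc ->]]] _]; have [? ? _ _] := fP _ Cc; exists 'X_l, (f c); split=> //.
  by rewrite dhomogX /= mdeg1.
move=> m im dm; have [l [c [Cc ->]]] := next_degree im dm.
have [? ? _ _] := fP _ Cc; exists ('X_l * f c); split.
- by exists l, c.
- exact: MM.
- by rewrite -add1n; apply: dhomogM; rewrite // dhomogX /= mdeg1.
- exact: (term_initial hle fP).
Qed.

End GroebnerConsequences.

(** * Strong stability *)

Section StronglyStable.
Variables (n : nat) (C : 'X_{1..n} -> Prop) (e : nat).
Hypothesis degC : forall c, C c -> mdeg c = e.
Hypothesis stable : forall c (i j : 'I_n), (i < j)%N -> C c -> c j != 0%N ->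
  C (U_(i) + (c - U_(j)))%MM.

(** The sum of the absolute differences of exponents, written with truncated subtraction in both
    directions. *)
Let dist (c c' : 'X_{1..n}) := (\sum_i ((c i - c' i) + (c' i - c i)))%N.

(** Equal degrees force an index j with c_j > c'_j, and j > i since c and c' agree before i.
    Replacing a factor X_j of c by X_i is allowed by stability, approaches c', and still divides m
    because c_i < c'_i <= m_i. *)
Lemma closer_neighbour m c c' (i : 'I_n) : C c -> C c' -> (c <= m)%MM -> (c' <= m)%MM ->
  (forall k : 'I_n, (k < i)%N -> c k = c' k) -> (c i < c' i)%N ->
  exists c2, mnm_edge C m c c2 /\ (dist c2 c' < dist c c')%N.
Proof.
move=> Cc Cc' cm c'm eq_lt lt_i.
have [j lt_j] : exists j, (c' j < c j)%N.
  apply/existsP; apply: contraT; rewrite negb_exists => /forallP le_c.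
  have := degC Cc; rewrite -(degC Cc') !mdegE => /eqP; rewrite eqn_leq => /andP[_].
  rewrite leqNgt => /negP[]; rewrite (bigD1 i) //= [X in (_ < X)%N](bigD1 i) //=.
  by rewrite -addSn leq_add // leq_sum // => k _; rewrite leqNgt le_c.
have ij : (i < j)%N.
  rewrite ltnNge leq_eqVlt; apply/negP => /orP[/eqP/val_inj ji|/eq_lt ej].
    by move: lt_j; rewrite ji ltnNge ltnW.
  by move: lt_j; rewrite ej ltnn.
have nij : i != j by apply: contraTneq ij => ->; rewrite ltnn.
have cj0 : c j != 0%N by rewrite -lt0n (leq_ltn_trans _ lt_j).
set c2 := (U_(i) + (c - U_(j)))%MM.
have c2i : c2 i = (c i).+1.
  by rewrite mnmDE mnmBE !mnm1E eqxx eq_sym (negPf nij) subn0 add1n.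
have c2j : c2 j = (c j).-1.
  by rewrite mnmDE mnmBE !mnm1E eqxx (negPf nij) add0n subn1.
have c2k k : k != i -> k != j -> c2 k = c k.
  by move=> ki kj; rewrite mnmDE mnmBE !mnm1E ![_ == k]eq_sym (negPf ki) (negPf kj) subn0.
exists c2; split.
  split=> //; first exact: stable.
    apply/mnm_lepP=> k; have [->|ki] := eqVneq k i.
      by rewrite c2i; apply: leq_trans lt_i _; move/mnm_lepP: c'm.
    apply: leq_trans (mnm_lepP cm k); have [->|kj] := eqVneq k j.
      by rewrite c2j leq_pred.
    by rewrite c2k.
  exists i, j; rewrite /c2 addmA [(U_(j) + _)%MM]addmC -addmA; congr (_ + _)%MM.
  by rewrite [RHS]addmC submK // lep1mP.
rewrite /dist (bigD1 i) //= [X in (_ < X)%N](bigD1 i) //= -addSn leq_add //.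
  rewrite c2i (eqP (ltnW lt_i : (c i - c' i == 0)%N)) (eqP (lt_i : ((c i).+1 - c' i == 0)%N)).
  by rewrite !add0n -subSn.
apply: leq_sum => k ki; have [->|kj] := eqVneq k j; last by rewrite c2k.
rewrite c2j; have le_j : (c' j <= (c j).-1)%N by rewrite -ltnS prednK ?lt0n.
rewrite (eqP (le_j : (c' j - (c j).-1 == 0)%N)) addn0.
by apply: leq_trans (leq_addr _ _); rewrite leq_sub2r // leq_pred.
Qed.

(** At the first index where c and c' differ, the one with the smaller exponent is moved towards the
    other; the path is thus built from both ends. *)
Lemma strongly_stable_connected : mnm_connected C.
Proof.
move=> m c c' Cc Cc' cm c'm.
have [d] := ubnP (dist c c'); elim: d c c' Cc Cc' cm c'm => // d IH c c' Cc Cc' cm c'm lt_d.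
have [->|ne] := eqVneq c c'; first exact: rst_refl.
have [i ne_i] : exists i, c i != c' i.
  apply/existsP; apply: contraNT ne; rewrite negb_exists => /forallP eqc.
  by apply/eqP/mnmP=> i; apply/eqP; rewrite -[_ == _]negbK eqc.
case: (@arg_minnP _ i (fun i => c i != c' i) (fun i => val i) ne_i) => {}i {}ne_i imin.
have eq_lt (k : 'I_n) : (k < i)%N -> c k = c' k.
  by move=> ki; apply/eqP; apply: contraLR ki => /imin; rewrite -leqNgt.
have [lt_i|lt_i|e_i] := ltngtP (c i) (c' i); last by rewrite e_i eqxx in ne_i.
- have [c2 [edge_c2 lt_c2]] := closer_neighbour Cc Cc' cm c'm eq_lt lt_i.
  apply: (@rst_trans _ _ _ c2); first exact: rst_step.
  by case: edge_c2 => _ ? _ ? _; apply: IH => //; apply: leq_trans lt_c2 (ltnSE lt_d).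
- have eq_lt' (k : 'I_n) : (k < i)%N -> c' k = c k by move/eq_lt.
  have [c2 [edge_c2 lt_c2]] := closer_neighbour Cc' Cc c'm cm eq_lt' lt_i.
  apply/rst_sym/(@rst_trans _ _ _ c2); first exact: rst_step.
  case: edge_c2 => _ ? _ ? _; apply: IH => //; apply: leq_trans lt_c2 _.
  apply: leq_trans (ltnSE lt_d); apply: leq_sum => k _; by rewrite addnC.
Qed.

End StronglyStable.

Lemma fraction_numden (R : idomainType) (x : {fraction R}) :
  exists a b, b != 0 /\ FracField.tofrac b * x = FracField.tofrac a.
Proof.
elim/quotW: x => r; exists \n_r, \d_r; split; first exact: denom_ratioP.
unlock FracField.tofrac; rewrite -[LHS]FracField.pi_mul; apply/eqmodP.
rewrite /= FracField.equivfE /FracField.mulf.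
by rewrite !numden_Ratio ?oner_neq0 ?mul1r ?denom_ratioP // mulr1 mulrC.
Qed.

(** * A derivation that kills the generic transforms *)

Section GenericDerivation.
Variables (n : nat) (F : fieldType).
Local Notation R := {mpoly F[n * n]}.
Local Notation yvar i j := ('X_(mxvec_index i j) : R).
Implicit Types (u v : {mpoly R[n]}) (c : R) (p : {mpoly F[n]}).

(** The generic transform before passing to fractions, so that the coefficients are polynomials in y
    and can be differentiated as such. *)
Definition generic_change_poly p : {mpoly R[n]} :=
  mmap (fun a => (a%:MP_[n * n])%:MP_[n]) (fun i => \sum_(j < n) yvar i j *: 'X_j) p.

Lemma map_generic_change_poly p :
  map_mpoly (@FracField.tofrac R) (generic_change_poly p) = generic_change p.
Proof.
rewrite /generic_change_poly /generic_change /mmap rmorph_sum /=.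
apply: eq_bigr => m _; rewrite rmorphM /= map_mpolyC; congr (_ * _).
rewrite /mmap1 rmorph_prod /=; apply: eq_bigr => i _.
rewrite rmorphXn /= rmorph_sum /=; congr (_ ^+ _); apply: eq_bigr => j _.
by rewrite map_mpolyZ map_mpolyX.
Qed.

Variables i j : 'I_n.

Definition coef_deriv c : R := \sum_k yvar k j * mderiv (mxvec_index k i) c.

Lemma coef_deriv_is_additive : additive coef_deriv.
Proof.
move=> a b; rewrite /coef_deriv -sumrB; apply: eq_bigr => k _.
by rewrite mderivB mulrBr.
Qed.
HB.instance Definition _ := GRing.isAdditive.Build R R coef_deriv coef_deriv_is_additive.

Lemma coef_derivM a b : coef_deriv (a * b) = coef_deriv a * b + a * coef_deriv b.
Proof.
rewrite /coef_deriv mulr_suml mulr_sumr -big_split; apply: eq_bigr => k _ /=.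
by rewrite mderivM mulrDr; congr (_ + _); [rewrite mulrA | rewrite mulrCA].
Qed.

Lemma coef_derivC (a : F) : coef_deriv a%:MP = 0.
Proof. by rewrite /coef_deriv big1 // => k _; rewrite mderivC mulr0. Qed.

Lemma coef_deriv_yvar k l : coef_deriv (yvar k l) = if l == i then yvar k j else 0.
Proof.
have inj (a b a' b' : 'I_n) :
    (mxvec_index a b == mxvec_index a' b') = ((a, b) == (a', b')).
  by rewrite /mxvec_index (inj_eq (@cast_ord_inj _ _ _)) (inj_eq enum_rank_inj).
rewrite /coef_deriv (bigD1 k) //= mderivX mnm1E inj xpair_eqE eqxx /=.
rewrite big1 => [|k' ne].
  case: ifP => [/eqP->|_]; last by rewrite scale0r mulr0 addr0.
  by rewrite scale1r addr0 submm mpolyX0 mulr1.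
by rewrite mderivX mnm1E inj xpair_eqE eq_sym (negPf ne) scale0r mulr0.
Qed.

(* The derivation sum_k y_kj d/dy_ki of the coefficients and X_i d/dX_j agree on
   the images sum_l y_kl X_l of the variables, hence on all generic transforms:
   both differentiate along the one-parameter group X_j -> X_j + t X_i. *)
Definition generic_deriv u : {mpoly R[n]} := 'X_i * mderiv j u - map_mpoly coef_deriv u.

Lemma generic_derivD u v : generic_deriv (u + v) = generic_deriv u + generic_deriv v.
Proof. by rewrite /generic_deriv mderivD raddfD /= mulrDr opprD addrACA. Qed.

Lemma map_coef_derivM u v : map_mpoly coef_deriv (u * v) =
  map_mpoly coef_deriv u * v + u * map_mpoly coef_deriv v.
Proof.
apply/mpolyP=> m; rewrite mcoeffD mcoeff_map_mpoly !mcoeffM raddf_sum -big_split.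
by apply: eq_bigr => k _ /=; rewrite coef_derivM !mcoeff_map_mpoly.
Qed.

Lemma generic_derivM u v :
  generic_deriv (u * v) = generic_deriv u * v + u * generic_deriv v.
Proof.
have aux (S : comNzRingType) (x a b c d f g : S) :
    x * (a * g + f * b) - (c * g + f * d) = (x * a - c) * g + f * (x * b - d).
  by rewrite mulrDr opprD addrACA mulrBl mulrBr mulrA [x * (f * b)]mulrCA.
by rewrite /generic_deriv mderivM map_coef_derivM; apply: aux.
Qed.

Lemma generic_deriv_change p : generic_deriv (generic_change_poly p) = 0.
Proof.
have dC (a : F) : generic_deriv a%:MP%:MP = 0.
  by rewrite /generic_deriv mderivC mulr0 map_mpolyC /= coef_derivC mpolyC0 subrr.
have dX k : generic_deriv (\sum_(l < n) yvar k l *: 'X_l) = 0.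
  rewrite /generic_deriv (raddf_sum (mderiv j)) (raddf_sum (map_mpoly coef_deriv)) /=.
  rewrite (bigD1 j) //= [X in _ * (_ + X)]big1 => [|l ne]; last first.
    by rewrite mderivZ mderivX mnm1E (negPf ne) scale0r scaler0.
  rewrite (bigD1 i) //= [X in _ - (_ + X)]big1 => [|l ne]; last first.
    apply/mpolyP=> m; rewrite mcoeff_map_mpoly mcoeffZ mcoeff0 mcoeffX /=.
    rewrite coef_derivM coef_deriv_yvar (negPf ne) mul0r add0r.
    by rewrite -[_%:R]mpolyC_nat coef_derivC mulr0.
  rewrite !addr0 mderivZ mderivX mnm1E eqxx scale1r.
  rewrite submm mpolyX0 -scalerAr mulr1.
  apply/eqP; rewrite subr_eq0; apply/eqP/mpolyP=> m.
  rewrite mcoeff_map_mpoly !mcoeffZ mcoeffX /= coef_derivM coef_deriv_yvar eqxx.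
  by rewrite -[_%:R]mpolyC_nat coef_derivC mulr0 addr0.
have d0M u v : generic_deriv u = 0 -> generic_deriv v = 0 -> generic_deriv (u * v) = 0.
  by move=> u0 v0; rewrite generic_derivM u0 v0 mul0r mulr0 addr0.
rewrite /generic_change_poly /mmap.
apply: (big_ind (fun u => generic_deriv u = 0)).
- by have := dC 0; rewrite !mpolyC0.
- by move=> u v u0 v0; rewrite generic_derivD u0 v0 addr0.
move=> m _; apply: (d0M); first exact: dC.
have d1 : generic_deriv 1 = 0 by have := dC 1; rewrite !mpolyC1.
apply: (big_ind (fun u => generic_deriv u = 0)); [exact: d1 | exact: d0M |].
move=> k _; elim: (m k) => [|a IH]; first by rewrite expr0; exact: d1.
by rewrite exprS; exact: (d0M _ _ (dX k) IH).
Qed.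

(** The derivation kills the generators, so the Leibniz rule leaves only multiples of them. *)
Lemma generic_deriv_ideal (I : {mpoly F[n]} -> Prop) u :
  ideal_gen (fun q => exists p, I p /\ q = generic_change_poly p) u ->
  ideal_gen (fun q => exists p, I p /\ q = generic_change_poly p) (generic_deriv u).
Proof.
set S := fun q => _; case=> r [rS ->].
have [J0 JD JM] := ideal_gen_is_ideal S.
elim: r rS => [|[a h] r IH] rS.
  by rewrite big_nil /generic_deriv mderiv0 (raddf0 (map_mpoly coef_deriv)) mulr0 subrr.
rewrite big_cons generic_derivD /=; apply: JD; last first.
  by apply: IH => y yr; apply: rS; rewrite inE yr orbT.
have /= Sh := rS _ (mem_head _ _); rewrite generic_derivM.
have -> : generic_deriv h = 0 by case: Sh => p [_ ->]; apply: generic_deriv_change.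
by rewrite mulr0 addr0; apply: JM; apply: ideal_gen_sub.
Qed.

Lemma mcoeff_generic_deriv u m : (generic_deriv u)@_m =
  (if m i != 0%N then u@_(m - U_(i) + U_(j))%MM *+ ((m - U_(i))%MM j).+1 else 0)
    - coef_deriv u@_m.
Proof.
rewrite mcoeffB mcoeff_map_mpoly; congr (_ - _).
case: ifPn => [mi|]; last first.
  rewrite negbK => /eqP mi; apply/eqP; rewrite mcoeff_eq0; apply/negP.
  rewrite mulrC (perm_mem (msuppMX _ _)) => /mapP[m' _ em].
  by move: mi; rewrite em mnmDE mnm1E eqxx.
have {1}-> : m = (U_(i) + (m - U_(i)))%MM by rewrite addmC submK // lep1mP.
by rewrite mulrC mcoeffMX mcoeff_mderiv.
Qed.

End GenericDerivation.

Section ClearDenominators.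
Variables (n : nat) (R : idomainType).
Local Notation tofrac := (@FracField.tofrac R).

Lemma clear_denominators (u : {mpoly {fraction R}[n]}) :
  exists q v, q != 0 /\ map_mpoly tofrac v = tofrac q *: u.
Proof.
elim/mpolyind: u => [|c m p _ _ [q [v [q0 ev]]]].
  by exists 1, 0; rewrite oner_neq0 raddf0 scaler0.
have [a [b [b0 eb]]] := fraction_numden c.
exists (b * q), (a * q *: 'X_[m] + b *: v); split; first by rewrite mulf_neq0.
rewrite rmorphD /= !map_mpolyZ map_mpolyX ev scalerDr !scalerA !rmorphM /=.
by rewrite -eb mulrAC.
Qed.

Lemma ideal_gen_clear (S : {mpoly R[n]} -> Prop) p :
  ideal_gen (fun q => exists2 v, S v & q = map_mpoly tofrac v) p ->
  exists q u, [/\ q != 0, ideal_gen S u & map_mpoly tofrac u = tofrac q *: p].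
Proof.
have [J0 JD JM] := ideal_gen_is_ideal S.
case=> r [rS ->]; elim: r rS => [|[a h] r IH] rS.
  by exists 1, 0; rewrite oner_neq0 big_nil raddf0 scaler0.
have [|q [u [q0 Ju eu]]] := IH.
  by move=> y yr; apply: rS; rewrite inE yr orbT.
have /= [h' Sh' eh] := rS _ (mem_head _ _).
have [b [v [b0 ev]]] := clear_denominators a.
exists (b * q), (q *: (v * h') + b *: u); split.
- by rewrite mulf_neq0.
- apply: JD; rewrite -mul_mpolyC; apply: (JM); last exact: Ju.
  by apply: (JM); apply: ideal_gen_sub.
- rewrite big_cons rmorphD /= !map_mpolyZ rmorphM /= ev eu -eh.
  rewrite -scalerAl !scalerA (rmorphM tofrac b q) scalerDr.
  by rewrite [tofrac q * _]mulrC.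
Qed.

End ClearDenominators.

Section StrongStability.
Variables (n : nat) (F : fieldType).
Local Notation R := {mpoly F[n * n]}.
Local Notation tofrac := (@FracField.tofrac R).

Definition change_ideal (I : {mpoly F[n]} -> Prop) : {mpoly (Fy n F)[n]} -> Prop :=
  ideal_gen (fun q => exists p, I p /\ q = generic_change p).

(** Clearing denominators keeps the support and brings p to polynomial coefficients, where
    [generic_deriv] acts. *)
Lemma change_ideal_integral (I : {mpoly F[n]} -> Prop) p : change_ideal I p ->
  exists q u, [/\ q != 0,
    ideal_gen (fun q => exists p, I p /\ q = generic_change_poly p) u
    & map_mpoly tofrac u = tofrac q *: p].
Proof.
move=> Jp; apply: ideal_gen_clear; apply: ideal_gen_mono Jp => _ [h [Ih ->]].
by exists (generic_change_poly h); [exists h | rewrite map_generic_change_poly].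
Qed.

Variables (le : rel 'X_{1..n}).
Hypothesis hle : monomial_order le.
Hypothesis hvars : decreasing_variables le.
Hypothesis char0 : forall k : nat, k.+1%:R != 0 :> F.

(* The initial monomial of generic_deriv i j u is c X_i / X_j, with coefficient
   c_j times that of c in u. *)
Lemma change_ideal_init_stable (I : {mpoly F[n]} -> Prop) c (i j : 'I_n) :
  init_mon le (change_ideal I) c -> (i < j)%N -> c j != 0%N ->
  init_mon le (change_ideal I) (U_(i) + (c - U_(j)))%MM.
Proof.
move=> [p Jp [pc pmax]] ij cj.
have [q [u [q0 Ju eu]]] := change_ideal_integral Jp.
have [_ _ JM] := ideal_gen_is_ideal (fun q => exists p, I p /\ q = generic_change p).
set c' := (U_(i) + (c - U_(j)))%MM.
have supp_u m : u@_m != 0 -> le m c.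
  move=> um; apply: pmax; move: um; rewrite -tofrac_eq0 -mcoeff_map_mpoly eu mcoeffZ.
  by rewrite mcoeff_msupp; apply: contraNneq => ->; rewrite mulr0.
have uc : u@_c != 0.
  rewrite -tofrac_eq0 -mcoeff_map_mpoly eu mcoeffZ mulf_neq0 ?tofrac_eq0 //.
  by rewrite -mcoeff_msupp.
have ec : c = (U_(j) + (c - U_(j)))%MM by rewrite addmC submK // lep1mP.
have lt_c : mlt le c c'.
  rewrite {1}ec /c' addmC [(U_(i) + _)%MM]addmC (mlt_add hle) /mlt eq_mnm1.
  have [_ _ tot _ _] := hle; have := tot U_(i)%MM U_(j)%MM.
  rewrite (negPf (hvars ij)) /= => ->.
  by apply: contraTneq ij => ->; rewrite ltnn.
(* X_i > X_j gives c' > c, and c is the largest monomial of u. *)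
have uc' : u@_c' = 0.
  apply/eqP; apply: contraT => /supp_u le_c'; case/andP: lt_c => h.
  by rewrite (mo_anti hle h le_c') eqxx.
have eshift : (c' - U_(i) = c - U_(j))%MM by rewrite /c' addmC addmK.
have ci : c' i != 0%N by rewrite /c' mnmDE mnm1E eqxx.
pose w := generic_deriv i j u.
(* The derivation of the coefficients contributes nothing at c'. What remains is c_j times the
   coefficient of c in u, and c_j is non-zero in characteristic 0. *)
have wc' : w@_c' != 0.
  rewrite mcoeff_generic_deriv ci eshift uc' raddf0 subr0.
  have -> : (c - U_(j) + U_(j) = c)%MM by rewrite submK // lep1mP.
  rewrite -mulr_natr mulf_neq0 // -mpolyC_nat mpolyC_eq0; exact: char0.
(* A monomial of w occurs in u, hence is at most c < c', or is X_i / X_j times a monomial of u. *)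
have supp_w m : w@_m != 0 -> le m c'.
  rewrite mcoeff_generic_deriv; have [um|] := eqVneq u@_m 0; last first.
    by move=> /supp_u h _; apply: (mo_trans hle h); apply: mlt_le lt_c.
  rewrite um raddf0 subr0; case: ifP => mi; last by rewrite eqxx.
  have [->|/supp_u h _] := eqVneq u@_(m - U_(i) + U_(j)) 0; first by rewrite mul0rn eqxx.
  have -> : m = (U_(i) + (m - U_(i)))%MM by rewrite addmC submK // lep1mP.
  by rewrite (mo_add hle) -(mo_add hle U_(j)) -ec addmC.
exists (map_mpoly tofrac w).
  have : ideal_gen (fun q => exists p, I p /\ q = generic_change_poly p) w.
    exact: generic_deriv_ideal.
  case=> r [rI ->]; rewrite rmorph_sum; apply: ideal_sum; first exact: ideal_gen_is_ideal.
  move=> x /rI[h [Ih ->]]; rewrite rmorphM /= map_generic_change_poly.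
  by apply: JM; apply: ideal_gen_sub; exists h.
split=> [|m]; rewrite mcoeff_msupp mcoeff_map_mpoly tofrac_eq0 //.
exact: supp_w.
Qed.

End StrongStability.

(** * The generic change of coordinates *)

Section LinearSubstitution.
Variables (n : nat) (E : fieldType).

Definition linear_subst (Y : 'M[E]_n) (p : {mpoly E[n]}) : {mpoly E[n]} :=
  p \mPo [tuple \sum_j Y i j *: 'X_j | i < n].

HB.instance Definition _ Y := GRing.RMorphism.copy (linear_subst Y)
  (comp_mpoly [tuple \sum_j Y i j *: 'X_j | i < n]).
HB.instance Definition _ Y := GRing.Linear.copy (linear_subst Y)
  (comp_mpoly [tuple \sum_j Y i j *: 'X_j | i < n]).

Lemma linear_substX Y i : linear_subst Y 'X_i = \sum_j Y i j *: 'X_j.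
Proof. by rewrite /linear_subst comp_mpolyXU -tnth_nth tnth_mktuple. Qed.

Lemma linear_subst_homog Y k p : p \is k.-homog -> linear_subst Y p \is k.-homog.
Proof.
move=> hp; rewrite -(pihomog_dE hp) pihomogE raddf_sum /=; apply: rpred_sum => m /eqP/= dm.
rewrite linearZ /=; apply: dhomogZ; rewrite /linear_subst comp_mpolyX.
have {dm} -> : k = (\sum_(i < n) m i)%N by rewrite -dm mdegE.
apply: (big_ind2 (fun (q : {mpoly E[n]}) d => q \is d.-homog)).
- exact: dhomog1.
- by move=> ? ? ? ?; apply: dhomogM.
- move=> i _; rewrite tnth_mktuple -[X in X.-homog]mul1n; apply: dhomogMn.
  by apply: rpred_sum => j _; apply: dhomogZ; rewrite dhomogX /= mdeg1.
Qed.

Lemma linear_substK Y p : Y \in unitmx -> linear_subst (invmx Y) (linear_subst Y p) = p.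
Proof.
move=> uY; elim/mpolyind: p => [|c m p _ _ IH]; first by rewrite !raddf0.
rewrite !linearD /= IH !linearZ /=; congr (_ *: _ + _).
rewrite mpolyXE_id !rmorph_prod /=; apply: eq_bigr => i _.
rewrite !rmorphXn /= linear_substX linear_sum /=; congr (_ ^+ _).
under eq_bigr => j _ do rewrite linearZ /= linear_substX scaler_sumr.
rewrite exchange_big /= (bigD1 i) //= [X in _ + X]big1 => [|k ki].
  under eq_bigr => j _ do rewrite scalerA.
  rewrite -scaler_suml addr0; have := mulmxV uY => /matrixP/(_ i i).
  by rewrite !mxE eqxx => ->; rewrite scale1r.
under eq_bigr => j _ do rewrite scalerA.
rewrite -scaler_suml; have := mulmxV uY => /matrixP/(_ i k).
by rewrite !mxE eq_sym (negPf ki) => ->; rewrite scale0r.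
Qed.

End LinearSubstitution.

Section GenericChange.
Variables (n : nat) (F : fieldType).
Local Notation E := (Fy n F).
Local Notation tofrac := (@FracField.tofrac {mpoly F[n * n]}).

Definition const_embed (p : {mpoly F[n]}) : {mpoly E[n]} :=
  map_mpoly (tofrac \o @mpolyC (n * n) F) p.

HB.instance Definition _ := GRing.RMorphism.copy const_embed
  (map_mpoly (tofrac \o @mpolyC (n * n) F)).

Definition generic_mx : 'M[E]_n := \matrix_(i, j) Fy_var F i j.

Lemma const_embed_inj : injective (tofrac \o @mpolyC (n * n) F).
Proof.
by move=> a b /= /eqP; rewrite tofrac_eq mpolyC_eq => /eqP.
Qed.

(** Separates the extension of scalars to F(y) from the substitution, which is invertible there. *)
Lemma generic_changeE p : generic_change p = linear_subst generic_mx (const_embed p).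
Proof.
rewrite /generic_change /linear_subst /comp_mpoly /mmap /const_embed.
rewrite (perm_big _ (msupp_map_mpoly _ const_embed_inj)) /=.
apply: eq_bigr => m _; rewrite mcoeff_map_mpoly; congr (_ * _).
apply: mmap1_eq => i; rewrite tnth_mktuple.
by apply: eq_bigr => j _; rewrite mxE.
Qed.

(** Specialising y to the identity matrix turns the determinant into 1, so it is a non-zero
    polynomial. *)
Lemma generic_mx_unit : generic_mx \in unitmx.
Proof.
pose Y := \matrix_(i, j) ('X_(mxvec_index i j) : {mpoly F[n * n]}).
have -> : generic_mx = map_mx tofrac Y by apply/matrixP=> i j; rewrite !mxE.
rewrite unitmxE det_map_mx unitfE tofrac_eq0.
pose v (k : 'I_(n * n)) := mxvec (1%:M : 'M[F]_n) 0 k.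
apply: contraTneq (oner_neq0 F) => Y0; rewrite negbK.
have <- : \det (map_mx (meval v) Y) = 1.
  rewrite (_ : map_mx _ _ = 1%:M) ?det1 //.
  by apply/matrixP=> i j; rewrite !mxE mevalXU /v mxvecE mxE.
by rewrite det_map_mx Y0 raddf0.
Qed.

Definition generic_inverse : {mpoly E[n]} -> {mpoly E[n]} := linear_subst (invmx generic_mx).

HB.instance Definition _ := GRing.RMorphism.copy generic_inverse
  (linear_subst (invmx generic_mx)).
HB.instance Definition _ := GRing.Linear.copy generic_inverse
  (linear_subst (invmx generic_mx)).

Lemma generic_changeK p : generic_inverse (generic_change p) = const_embed p.
Proof. by rewrite generic_changeE /generic_inverse linear_substK ?generic_mx_unit. Qed.

Lemma const_embed_homog k p : p \is k.-homog -> const_embed p \is k.-homog.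
Proof.
move=> /dhomogPn hp; apply/dhomogPn => m; rewrite mcoeff_map_mpoly => h.
by apply: hp; apply: contraNneq h => ->; rewrite raddf0.
Qed.

Lemma generic_change_homog k (p : {mpoly F[n]}) : p \is k.-homog -> generic_change p \is k.-homog.
Proof. by move=> hp; rewrite generic_changeE; apply/linear_subst_homog/const_embed_homog. Qed.

Lemma generic_changeM (p q : {mpoly F[n]}) :
  generic_change (p * q) = generic_change p * generic_change q.
Proof. by rewrite !generic_changeE !rmorphM. Qed.

Lemma generic_change_sum (T : Type) (r : seq T) (P : pred T) (f : T -> {mpoly F[n]}) :
  generic_change (\sum_(t <- r | P t) f t) = \sum_(t <- r | P t) generic_change (f t).
Proof.
apply: (big_morph (@generic_change n F)) => [p q|].
  by rewrite !generic_changeE !rmorphD.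
by rewrite generic_changeE !rmorph0.
Qed.

Lemma change_ideal_mem (I : {mpoly F[n]} -> Prop) p : I p -> change_ideal I (generic_change p).
Proof. by move=> Ip; apply: ideal_gen_sub; exists p. Qed.

Lemma change_ideal_homog (I : {mpoly F[n]} -> Prop) :
  homogeneous_ideal I -> homogeneous_ideal (change_ideal I).
Proof.
move=> [_ hI]; have idJ : is_ideal (change_ideal I) by apply: ideal_gen_is_ideal.
split=> // q k [r [rI ->]]; rewrite linear_sum; apply: ideal_sum => // -[a _] /rI[p [Ip /= ->]].
have [l ->] := pihomog_sumE p; rewrite generic_change_sum mulr_sumr linear_sum.
apply: ideal_sum => // d _ /=; rewrite (pihomogM_homog _ _ (generic_change_homog (pihomogP _ d p))).
case: ifP => _; last by case: idJ.
by case: idJ => _ _; apply; apply: change_ideal_mem; apply: hI.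
Qed.

Lemma change_ideal_below (I : {mpoly F[n]} -> Prop) k :
  (forall p, I p -> ideal_gen (homog_below I k) p) ->
  forall q, change_ideal I q -> ideal_gen (homog_below (change_ideal I) k) q.
Proof.
have idG := ideal_gen_is_ideal (homog_below (change_ideal I) k).
move=> gen; apply: ideal_gen_min => // _ [p [/gen[r [rI ->]] ->]].
rewrite generic_change_sum; apply: ideal_sum => // x /rI[Ix [j jk hx]].
rewrite generic_changeM; case: idG => _ _; apply; apply: ideal_gen_sub.
by split; [apply: change_ideal_mem | exists j => //; apply: generic_change_homog].
Qed.

End GenericChange.

(** * Monomial ideals described by their sets of monomials *)

Section MonomialIdeals.
Variables (n : nat) (F : fieldType).
Implicit Types (S : 'X_{1..n} -> Prop) (I : {mpoly F[n]} -> Prop).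

Definition upward S := forall u m, S m -> S (u + m)%MM.

(** The set S does not mention the field, so a monomial ideal and its base changes are described by
    the same S. *)
Definition monomial_ideal_of I S := forall q, I q <-> forall m, m \in msupp q -> S m.

Lemma monomial_ideal_X I S m : monomial_ideal_of I S -> I 'X_[m] <-> S m.
Proof.
move=> IS; split=> [/IS|Sm]; first by apply; rewrite msuppX mem_head.
by apply/IS => m'; rewrite msuppX inE => /eqP->.
Qed.

Lemma monomial_ideal_gen S : upward S ->
  monomial_ideal_of (ideal_gen (fun q => exists m, S m /\ q = 'X_[m])) S.
Proof.
move=> up q; have idG := ideal_gen_is_ideal (fun q : {mpoly F[n]} => exists m, S m /\ q = 'X_[m]).
split=> [[r [rS ->]]|Sq].
  move=> m /msupp_sum_le /flatten_mapP[x]; rewrite filter_predT => /rS[c [Sc ->]].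
  by move=> /msuppM_le /allpairsP[[m1 m2] [_ /=]]; rewrite msuppX inE => /eqP-> ->; apply: up.
rewrite [q]mpolyE; apply: ideal_sum => // m /Sq Sm.
by apply: ideal_scale => //; apply: ideal_gen_sub; exists m.
Qed.

Lemma monomial_ideal_homog I S : upward S -> monomial_ideal_of I S -> homogeneous_ideal I.
Proof.
move=> up IS; split; first split.
- by apply/IS => m; rewrite msupp0.
- move=> p q /IS Ip /IS Iq; apply/IS => m /msuppD_le; rewrite mem_cat.
  by case/orP=> [/Ip|/Iq].
- move=> a p /IS Ip; apply/IS => m /msuppM_le /allpairsP[[m1 m2] [_ /= /Ip Sm2 ->]].
  exact: up.
move=> p k /IS Ip; apply/IS => m; rewrite mcoeff_msupp mcoeff_pihomog.
by case: ifP => [_|]; [rewrite -mcoeff_msupp; apply: Ip | rewrite eqxx].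
Qed.

(** Makes the absence of new generators a combinatorial property of S, which can be carried from one
    field to another. *)
Lemma monomial_no_new_gen I S k : upward S -> monomial_ideal_of I S ->
  no_new_gen I k <->
  forall m, S m -> mdeg m = k -> exists i c, S c /\ m = (U_(i) + c)%MM.
Proof.
move=> up IS; split=> [new m Sm dm|step f If hf].
  have [||r [rI em]] := new 'X_[m].
  - exact/(monomial_ideal_X m IS).
  - by rewrite dhomogX; apply/eqP.
  have : m \in msupp ('X_[m] : {mpoly F[n]}) by rewrite msuppX mem_head.
  rewrite em => /msupp_sum_le /flatten_mapP[x]; rewrite filter_predT.
  move=> /rI[/IS Ix [j jk /dhomogP hx]] /msuppM_le /allpairsP[[u c] [/= _ cx em']].
  have dc : mdeg c = j by apply: hx.
  have [|i [u' eu]] := @mnm_splitU _ u.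
    by rewrite -(ltn_add2r (mdeg c)) -mdegD -em' dm dc.
  by exists i, (u' + c)%MM; split; [apply/up/Ix | rewrite em' eu addmA].
have idG := ideal_gen_is_ideal (homog_below I k).
rewrite [f]mpolyE; apply: ideal_sum => // m mf; apply: ideal_scale => //.
have dm : mdeg m = k by move/dhomogP: hf; apply.
have Sm : S m by move/IS: If; apply.
have [i [c [Sc em]]] := step m Sm dm.
rewrite em mpolyXD; case: idG => _ _; apply; apply: ideal_gen_sub.
split; first exact/(monomial_ideal_X c IS).
exists (mdeg c); first by rewrite -dm em mdegD mdeg1.
by rewrite dhomogX.
Qed.

End MonomialIdeals.

Lemma base_change_monomial n (F F' : fieldType) (I : {mpoly F[n]} -> Prop) S :
  upward S -> monomial_ideal_of I S -> monomial_ideal_of (base_change (F' := F') I) S.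
Proof.
move=> up IS q; rewrite -(monomial_ideal_gen (F := F') up q).
split; apply: ideal_gen_mono => _ [m [/(monomial_ideal_X m IS) h ->]]; by exists m.
Qed.

Lemma initial_ideal_monomial n (F : fieldType) le (J : {mpoly F[n]} -> Prop) :
  monomial_order le -> is_ideal J ->
  monomial_ideal_of (initial_ideal le J) (init_mon le J).
Proof.
move=> hle idJ q; rewrite -(monomial_ideal_gen (F := F) (fun u m => init_mon_mul hle u idJ) q).
split; apply: ideal_gen_mono => x.
  by move=> [p [m [Jp pm ->]]]; exists m; split=> //; exists p.
by move=> [m [[p Jp pm] ->]]; exists p, m.
Qed.

Section GenericInitialIdeals.
Variables (n : nat) (le : rel 'X_{1..n}).
Hypothesis hle : monomial_order le.

Definition gin_mon (F : fieldType) (I : {mpoly F[n]} -> Prop) := init_mon le (change_ideal I).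

Lemma gin_mon_upward (F : fieldType) (I : {mpoly F[n]} -> Prop) : upward (gin_mon I).
Proof. by move=> u m; apply: init_mon_mul => //; apply: ideal_gen_is_ideal. Qed.

Lemma gin_monomial (F : fieldType) (I : {mpoly F[n]} -> Prop) :
  monomial_ideal_of (gin le I) (gin_mon I).
Proof.
have idJ : is_ideal (change_ideal I) by apply: ideal_gen_is_ideal.
exact: (base_change_monomial (F' := F) (@gin_mon_upward F I) (initial_ideal_monomial hle idJ)).
Qed.

End GenericInitialIdeals.

(** * Transfer of linear syzygies to a monomial ideal *)

Section ComponentRestriction.
Variables (n : nat) (E : fieldType) (S : 'X_{1..n} -> Prop) (e : nat).
Variables (T : pred 'X_{1..n}) (m : 'X_{1..n}).
Local Notation A := {mpoly E[n]}.
Local Notation B := (fun b => S b /\ mdeg b = e).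
Hypothesis T_edge : forall b b', mnm_edge B m b b' -> T b -> T b'.

Definition restrict (v : A) : A := \sum_(b <- msupp v | T b) v@_b *: 'X_[b].

Lemma restrict_is_linear : linear restrict.
Proof.
move=> a x y; apply/mpolyP=> b; rewrite mcoeffD mcoeffZ !mcoeff_restrict.
by rewrite mcoeffD mcoeffZ; case: ifP => // _; rewrite mulr0 addr0.
Qed.

Lemma restrictX b : restrict 'X_[b] = if T b then 'X_[b] else 0.
Proof.
apply/mpolyP=> b'; rewrite mcoeff_restrict mcoeffX.
have [->|ne] := eqVneq b b'; first by case: ifP; rewrite ?mcoeffX ?eqxx ?mcoeff0.
by rewrite if_same; case: ifP; rewrite ?mcoeffX ?(negPf ne) ?mcoeff0.
Qed.

(** The monomials b of B with w = X_i b for some i divide m and are pairwise joined by edges, so T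
    contains all of them or none. Only these b contribute to the coefficient of w in l v. *)
Lemma mcoeff_linear_restrict w : (w <= m)%MM -> exists t : bool,
  forall l v : A, l \is 1.-homog -> v \is e.-homog -> (forall b, b \in msupp v -> S b) ->
  (l * restrict v)@_w = if t then (l * v)@_w else 0.
Proof.
move=> wm.
case: (excluded_middle_informative
    (exists i b, [/\ T b, S b, mdeg b = e & w = (U_(i) + b)%MM])) => [Pw|Pw];
  [exists true | exists false] => l v /dhomogPn hl /dhomogPn hv Sv; rewrite !mcoeffM.
- apply: eq_bigr => -[k1 k2] /= /eqP; move: (bmnm k1) (bmnm k2) => {}k1 {}k2 ew.
  rewrite mcoeff_restrict.
  case: ifP => // Tk; have [->|l0] := eqVneq l@_k1 0; first by rewrite !mul0r.
  have [->|v0] := eqVneq v@_k2 0; first by rewrite mulr0.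
  have /eqP/mdeg1P[j /eqP ek] := hl _ l0; case/negP: Tk.
  have [i [b [Tb Sb db ewb]]] := Pw; apply: (T_edge (b := b)) Tb.
  split=> //.
  - by split; [apply: Sv; rewrite mcoeff_msupp | apply: hv].
  - by apply: lepm_trans wm; rewrite ewb lem_addl.
  - by apply: lepm_trans wm; rewrite ew lem_addl.
  - by exists i, j; rewrite -ewb ew ek.
apply: big1 => -[k1 k2] /= /eqP; move: (bmnm k1) (bmnm k2) => {}k1 {}k2 ew.
rewrite mcoeff_restrict.
have [->|l0] := eqVneq l@_k1 0; first by rewrite mul0r.
have [->|v0] := eqVneq v@_k2 0; first by rewrite if_same mulr0.
have /eqP/mdeg1P[j /eqP ek] := hl _ l0; case: ifP => Tk; last by rewrite mulr0.
case: Pw; exists j, k2; split=> //.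
- by apply: Sv; rewrite mcoeff_msupp.
- exact: hv.
- by rewrite ew ek.
Qed.

(** The coefficient of m in u x, with x the combination of the l [restrict v], depends only on the
    coefficients of x at divisors w of m. Each of these equals the coefficient of w in the syzygy,
    which is 0, or is 0 outright. *)
Lemma restrict_linear_syzygy (u : A) y :
  lspan (fun y : (A * E^o)%type => exists l v,
    [/\ l \is 1.-homog, v \is e.-homog, forall b, b \in msupp v -> S b
      & y = (l * v, (u * l * restrict v)@_m)]) y ->
  y.1 = 0 -> y.2 = 0.
Proof.
move=> span_y y0.
have [x [-> xw]] : exists x : A, y.2 = (u * x)@_m /\
    forall w, (w <= m)%MM -> (y.1)@_w = 0 -> x@_w = 0.
  suff [x [yx xw]] : exists x : A, y.2 = (u * x)@_m /\
      forall w, (w <= m)%MM -> exists t : bool, x@_w = if t then (y.1)@_w else 0.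
    exists x; split=> // w wm yw; have [t ->] := xw w wm.
    by rewrite yw if_same.
  (* The boolean is fixed from w alone before the induction on the combination, so that it is common
     to all summands. *)
  suff [x [yx xw]] : exists x : A, y.2 = (u * x)@_m /\
      forall w (wm : (w <= m)%MM), x@_w =
        if sval (constructive_indefinite_description _ (mcoeff_linear_restrict wm))
        then (y.1)@_w else 0.
    by exists x; split=> // w wm; rewrite xw; eexists.
  elim: span_y {y0} => [|a _ y' [l [v [hl hv Sv ->]]] _ [x [yx xw]]].
    by exists 0; rewrite mulr0 mcoeff0; split=> // w wm; rewrite mcoeff0 if_same.
  exists (a *: (l * restrict v) + x); split.
    by rewrite mulrDr -scalerAr mcoeffD mcoeffZ mulrA -yx.
  move=> w wm; rewrite mcoeffD mcoeffZ xw /=.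
  case: constructive_indefinite_description => t /= /(_ _ _ hl hv Sv) ->.
  by case: t; rewrite ?mcoeffD ?mcoeffZ // mulr0 addr0.
rewrite mcoeffM big1 // => -[k1 k2] /= /eqP; move: (bmnm k1) (bmnm k2) => {}k1 {}k2 em.
by rewrite xw ?mulr0 ?y0 ?mcoeff0 // em lem_addl.
Qed.

End ComponentRestriction.

Section Transfer.
Variables (n : nat) (le : rel 'X_{1..n}).
Hypothesis hle : monomial_order le.
Variables (F : fieldType) (N : {mpoly F[n]} -> Prop) (S : 'X_{1..n} -> Prop) (e : nat).
Hypothesis upS : upward S.
Hypothesis NS : monomial_ideal_of N S.
Local Notation E := (Fy n F).
Local Notation A := {mpoly E[n]}.
Local Notation M := (change_ideal N).
Local Notation B := (fun b => S b /\ mdeg b = e).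
Hypothesis next_degree : forall w, init_mon le M w -> mdeg w = e.+1 ->
  exists i c, init_deg le M e c /\ w = (U_(i) + c)%MM.
Hypothesis connected : mnm_connected (init_deg le M e).

Let hM : homogeneous_ideal M.
Proof. exact/change_ideal_homog/(monomial_ideal_homog upS NS). Qed.

(** The inverse substitution sends the generators of M back to elements of N, hence M into the
    monomial ideal of S over F(y). *)
Lemma generic_inverse_supp p : M p -> forall m, m \in msupp (generic_inverse p) -> S m.
Proof.
pose J (q : A) := forall m, m \in msupp q -> S m.
have [[J0 JD JM] _] : homogeneous_ideal J by apply: monomial_ideal_homog upS _.
apply: (ideal_gen_min (I := fun p : A => J (generic_inverse p))).
  split=> [|x y|a x].
  - by rewrite rmorph0.
  - by rewrite rmorphD; exact: JD.
  - by rewrite rmorphM; exact: JM.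
move=> _ [q [/NS Nq ->]] m; rewrite generic_changeK.
by rewrite (perm_mem (msupp_map_mpoly _ (@const_embed_inj n F))); apply: Nq.
Qed.

(** Keeps only the properties of the inverse substitution that the transfer relies on and hides its
    matrix. *)
Lemma undo_generic_change : exists G : A -> A,
  [/\ linear G, {morph G : x y / x * y},
      forall k p, p \is k.-homog -> G p \is k.-homog,
      forall m, G (generic_change ('X_[m] : {mpoly F[n]})) = 'X_[m]
    & forall p, M p -> forall m, m \in msupp (G p) -> S m].
Proof.
exists (@generic_inverse n F); split.
- exact: linearP.
- exact: rmorphM.
- by move=> k p; apply: linear_subst_homog.
- by move=> m; rewrite generic_changeK /const_embed map_mpolyX.
- exact: generic_inverse_supp.
Qed.

Lemma change_monomial m : S m -> M (generic_change 'X_[m]).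
Proof. by move=> Sm; apply/change_ideal_mem/(monomial_ideal_X m NS). Qed.

Lemma change_monomial_homog m :
  generic_change ('X_[m] : {mpoly F[n]}) \is (mdeg m).-homog.
Proof. by apply: generic_change_homog; rewrite dhomogX. Qed.

(** The transform of X^w is a combination of products l v with v in M of degree e. Undoing the
    change of coordinates, w occurs in some product of a linear form with an element whose monomials
    lie in S. *)
Lemma monomial_next_degree w : S w -> mdeg w = e.+1 ->
  exists i c, S c /\ w = (U_(i) + c)%MM.
Proof.
move=> Sw dw; have hw := change_monomial_homog w; rewrite dw in hw.
have [G [Glin GM Ghom GX Gsupp]] := undo_generic_change.
have span_w := next_degree_span hle hM next_degree (change_monomial Sw) hw.
have : w \in msupp ('X_[w] : A) by rewrite msuppX mem_head.
rewrite -GX; elim: span_w => [|a _ x [l [v [hl Mv hv ->]]] _ IH].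
  by rewrite (linear_fun0 Glin) msupp0.
rewrite Glin GM => /msuppD_le; rewrite mem_cat => /orP[|//].
move=> /msuppZ_le/msuppM_le/allpairsP[[m1 c] [/= lm1 vc ew]].
have /dhomogP/(_ _ lm1)/eqP/mdeg1P[i /eqP em1] := Ghom _ _ hl.
by exists i, c; split; [apply: Gsupp vc | rewrite ew em1].
Qed.

(* On the component of c in the graph of divisors of m, the functional
   (u, v) |-> [m](u * restrict v) kills linear syzygies; evaluated on the syzygy
   between c and c', it forces c' to lie in that component. *)
Lemma monomial_connected : mnm_connected B.
Proof.
move=> m c c' [Sc dc] [Sc' dc'] cm c'm.
pose T b : bool := excluded_middle_informative (clos_refl_sym_trans _ (mnm_edge B m) c b).
have TP b : T b -> clos_refl_sym_trans _ (mnm_edge B m) c b.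
  by rewrite /T; case: excluded_middle_informative.
have PT b : clos_refl_sym_trans _ (mnm_edge B m) c b -> T b.
  by rewrite /T; case: excluded_middle_informative.
have T_edge b b' : mnm_edge B m b b' -> T b -> T b'.
  by move=> bb' /TP cb; apply: PT; apply: rst_trans cb _; apply: rst_step.
apply: TP.
have [G [Glin GM Ghom GX Gsupp]] := undo_generic_change.
pose Phi (u v : A) : E := (G u * restrict T (G v))@_m.
have Phi_l v : linear (fun u => Phi u v : E^o).
  by move=> a x y; rewrite /Phi Glin mulrDl -scalerAl mcoeffD mcoeffZ.
have Phi_r u : linear (fun v => Phi u v : E^o).
  move=> a x y; rewrite /Phi Glin restrict_is_linear mulrDr -scalerAr.
  by rewrite mcoeffD mcoeffZ.
have syz u z : lspan (fun y : (A * E^o)%type => exists l v,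
    [/\ l \is 1.-homog, M v, v \is e.-homog & y = (l * v, Phi (u * l) v)]) (0, z) -> z = 0.
  move=> span_z.
  apply: (@restrict_linear_syzygy _ _ S e T m T_edge (G u) (G 0, z)); last exact: linear_fun0.
  apply: (lspan_map (f := fun y : (A * E^o)%type => (G y.1, y.2) : (A * E^o)%type)) span_z.
    by move=> a x y; congr pair; apply: Glin.
  move=> _ [l [v [hl Mv hv ->]]]; apply: lspan_sub.
  exists (G l), (G v); split; [exact: Ghom | exact: Ghom | exact: Gsupp |].
  by rewrite /Phi /= !GM.
have PhiE p q x y : G p = x -> G q = y -> Phi p q = (x * restrict T y)@_m by move=> <- <-.
have PhiX b : (b <= m)%MM ->
    Phi (generic_change 'X_[m - b]) (generic_change 'X_[b]) = (T b)%:R.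
  move=> bm; rewrite (PhiE _ _ _ _ (GX _) (GX _)) restrictX.
  case: (T b); last by rewrite mulr0 mcoeff0.
  by rewrite -mpolyXD submK // mcoeffX eqxx.
have span_b b : B b -> (b <= m)%MM -> lspan (fun y : (A * E^o)%type =>
    exists u v, [/\ u \is (mdeg m - e).-homog, M v, v \is e.-homog & y = (u * v, Phi u v)])
    (generic_change 'X_[m], (T b)%:R).
  move=> [Sb db] bm; apply: lspan_sub.
  exists (generic_change 'X_[m - b]), (generic_change 'X_[b]); split.
  - have -> : (mdeg m - e)%N = mdeg (m - b)%MM; last exact: change_monomial_homog.
    by rewrite -{1}(submK bm) mdegD db addnK.
  - exact: change_monomial.
  - by rewrite -db; apply: change_monomial_homog.
  - by rewrite PhiX // -generic_changeM -mpolyXD submK.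
have pairB (g : A) (a b : E^o) : (g, a) - (g, b) = (0, a - b) :> A * E^o.
  by congr pair; rewrite subrr.
have Tc : T c by apply: PT; apply: rst_refl.
have := lspan_diff (span_b c (conj Sc dc) cm) (span_b c' (conj Sc' dc') c'm).
rewrite pairB Tc.
move/(linear_syzygies_generate hle hM next_degree connected Phi_l Phi_r syz).
by case: (T c') => // /eqP; rewrite subr0 oner_eq0.
Qed.

End Transfer.

(** * The zero-generic initial ideal *)

Section ZeroGeneric.
Variables (n : nat) (K : fieldType) (le : rel 'X_{1..n}).
Hypothesis hle : monomial_order le.
Hypothesis hvars : decreasing_variables le.
Variables (I : {mpoly K[n]} -> Prop) (e : nat).
Hypothesis hI : homogeneous_ideal I.
Hypothesis I_below : forall k, (e < k)%N -> no_new_gen I k.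

Local Notation N := (base_change (F' := rat) (gin le I)).
Local Notation S1 := (gin_mon le I).
Local Notation S2 := (gin_mon le N).

Lemma gin_rat_monomial : monomial_ideal_of N S1.
Proof. exact: (base_change_monomial (@gin_mon_upward n le hle K I) (gin_monomial hle I)). Qed.

Lemma gin0_monomial : monomial_ideal_of (gin0 le I) S2.
Proof. exact: (base_change_monomial (@gin_mon_upward n le hle _ N) (gin_monomial hle N)). Qed.

Hypothesis gin0_next : no_new_gen (gin0 le I) e.+1.

Lemma gin0_no_new_gen k : (e < k)%N -> no_new_gen (gin0 le I) k.
Proof.
have up1 : upward S1 by apply: gin_mon_upward.
have up2 : upward S2 by apply: gin_mon_upward.
have hN : homogeneous_ideal N := monomial_ideal_homog up1 gin_rat_monomial.
have hM2 := change_ideal_homog hN; have hM1 := change_ideal_homog hI.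
have next2 w : S2 w -> mdeg w = e.+1 ->
    exists i c, init_deg le (change_ideal N) e c /\ w = (U_(i) + c)%MM.
  move=> Sw dw.
  have [i [c [Sc ew]]] := (monomial_no_new_gen e.+1 up2 gin0_monomial).1 gin0_next w Sw dw.
  exists i, c; split=> //; split=> //.
  by move/eqP: dw; rewrite ew mdegD mdeg1 add1n eqSS => /eqP.
(* Strong stability is available whatever the characteristic of K, since N is an ideal over
   [rat]. *)
have conn2 : mnm_connected (init_deg le (change_ideal N) e).
  apply: (strongly_stable_connected (e := e)) => [c []//|c i j ij [Sc dc] cj].
  split.
    apply: change_ideal_init_stable => //.
    by move=> d; rewrite Num.Theory.pnatr_eq0.
  by rewrite mdegD mdeg1 -{1}(mdeg1 j) -mdegD addmC submK // lep1mP.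
(* Obtained through N over [rat], yet a statement about gin(I): both have the monomials [S1]. *)
have next1 w : S1 w -> mdeg w = e.+1 ->
    exists i c, init_deg le (change_ideal I) e c /\ w = (U_(i) + c)%MM.
  move=> Sw dw.
  have [i [c [Sc ew]]] := monomial_next_degree hle up1 gin_rat_monomial next2 Sw dw.
  exists i, c; split=> //; split=> //.
  by move/eqP: dw; rewrite ew mdegD mdeg1 add1n eqSS => /eqP.
have conn1 : mnm_connected (init_deg le (change_ideal I) e).
  exact: (monomial_connected hle up1 gin_rat_monomial next2 conn2).
have gen1 := initial_generated hle hM1 next1 conn1
  (change_ideal_below (no_new_gen_below hI I_below)).
(* For l > e the quotient m / c is not 1; one variable is split off from it and the rest stays in
   S. *)
have below (F : fieldType) (J : {mpoly F[n]} -> Prop) (S : 'X_{1..n} -> Prop) l :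
    upward S -> monomial_ideal_of J S ->
    (forall m, S m -> (e <= mdeg m)%N -> exists2 c, S c /\ mdeg c = e & (c <= m)%MM) ->
    (e < l)%N -> no_new_gen J l.
  move=> up JS gen el; apply/(monomial_no_new_gen l up JS) => m Sm dm.
  have [|c [Sc dc] cm] := gen m Sm; first by rewrite dm ltnW.
  have [|i [u eu]] := @mnm_splitU _ (m - c)%MM.
    by rewrite -(ltn_add2r (mdeg c)) -mdegD submK // dm dc.
  by exists i, (u + c)%MM; split; [apply: up | rewrite addmA -eu submK].
(* The degree bound found over K(y) returns to [rat] through the common set [S1]. *)
have N_below l : (e < l)%N -> no_new_gen N l by apply: below gin_rat_monomial gen1.
have gen2 := initial_generated hle hM2 next2 conn2
  (change_ideal_below (no_new_gen_below hN N_below)).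
exact: below gin0_monomial gen2.
Qed.

End ZeroGeneric.

(** A non-zero homogeneous element of least degree would be a new generator. This serves the case d
    <= 0. *)
Lemma no_new_gen_zero n (F : fieldType) (I : {mpoly F[n]} -> Prop) :
  homogeneous_ideal I -> (forall k, no_new_gen I k) -> forall p, I p -> p = 0.
Proof.
move=> [_ hI] new p Ip.
have id0 : is_ideal (fun q : {mpoly F[n]} => q = 0).
  by split=> // [x y -> ->|a x ->]; rewrite ?addr0 ?mulr0.
apply: (@ideal_pihomog_eq n F (fun q => q = 0)) => // k.
have: pihomog mdeg k p \is k.-homog by apply: pihomogP.
have: I (pihomog mdeg k p) by apply: hI.
move: (pihomog mdeg k p) => {Ip}p.
have [l] := ubnP k; elim: l k p => // l IH k p kl Ip hp.
apply: (ideal_gen_min id0) (new _ _ Ip hp) => q [Iq [i ik hq]].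
exact: (IH i q (leq_trans ik kl) Iq hq).
Qed.

Lemma gin_mon_zero n le (F : fieldType) (I : {mpoly F[n]} -> Prop) m :
  (forall p, I p -> p = 0) -> ~ gin_mon le I m.
Proof.
move=> I0 [p Jp [pm _]].
have id0 : is_ideal (fun q : {mpoly (Fy n F)[n]} => q = 0).
  by split=> // [x y -> ->|a x ->]; rewrite ?addr0 ?mulr0.
suff p0 : p = 0 by rewrite p0 msupp0 in pm.
apply: (ideal_gen_min id0) Jp => _ [q [/I0 -> ->]].
by rewrite generic_changeE !rmorph0.
Qed.

Theorem theorem2p8 (K : fieldType) (n : nat) (I : {mpoly K[n]} -> Prop)
    (tau : rel 'X_{1..n}) (d : int)
    (hI : homogeneous_ideal I)
    (htau : monomial_order tau)
    (hvars : decreasing_variables tau)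
    (hgens : forall e : int, d <= e -> ~ has_min_gen_in_degree I e)
    (hd : ~ has_min_gen_in_degree (gin0 tau I) d) :
  forall e : int, d < e -> ~ has_min_gen_in_degree (gin0 tau I) e.
Proof.
have hg : homogeneous_ideal (gin0 tau I).
  by apply: monomial_ideal_homog (gin0_monomial htau I); apply: gin_mon_upward.
(* A degree that carries a minimal generator is a natural number k. *)
move=> e de he; have [_ [_ [k [_ _ _ ek]]]] := he; move: de he; rewrite ek {ek} => dk.
apply: no_new_gen_no_min_gen => //.
have I_new l : d <= l%:Z -> no_new_gen I l.
  by move=> dl; apply: no_min_gen_no_new_gen => //; apply: hgens.
have hd_new l : d = l%:Z -> no_new_gen (gin0 tau I) l.
  by move=> edl; apply: no_min_gen_no_new_gen => //; rewrite -edl.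
(* If I = 0, then gin(I), its transport to [rat] and the gin of the latter contain no monomial. *)
have vanishes : (forall l, no_new_gen I l) -> no_new_gen (gin0 tau I) k.
  move=> new; have I0 := no_new_gen_zero hI new.
  have up : upward (gin_mon tau (base_change (F' := rat) (gin tau I))).
    exact: gin_mon_upward.
  apply/(monomial_no_new_gen k up (gin0_monomial htau I)) => m Sm _.
  case: (gin_mon_zero _ Sm) => p /(gin_rat_monomial htau) Np.
  apply/mpolyP=> m'; rewrite mcoeff0; apply/eqP; rewrite mcoeff_eq0; apply/negP => /Np.
  exact: gin_mon_zero.
(* For d <= 0 the hypothesis on I covers all degrees, so I = 0. For d = e' + 1 the previous section
   applies with e = e'. *)
case: d {hgens hd} dk I_new hd_new => [[|e']|e'] dk I_new hd_new.
- by apply: vanishes => l; apply: I_new.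
- apply: (@gin0_no_new_gen n K tau htau hvars I e' hI).
  + exact: I_new.
  + exact: hd_new.
  + by apply: ltnW; rewrite -ltz_nat.
- by apply: vanishes => l; apply: I_new.
Qed.
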